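(* Let $\lambda>0$, $\ell>0$ and let $\gamma\in A_\ell$ be a penalized pinned elastica. If the arclength parametrization of $\gamma$ is $\gamma_{\rm sarc}^{\lambda,\ell,n}$, $\gamma_{\rm larc}^{\lambda,\ell,n}$, or $\gamma_{\rm loop}^{\lambda,\ell,n}$ for some integer $n\ge3$ (for which the respective curve is defined), then $\gamma$ is not a local minimizer of $\mathcal{E}_\lambda$ in $A_\ell$.
   Context: Elliptic functions: for $q\in[0,1)$, $x\in\mathbb{R}$, $\mathrm{F}(x,q)=\int_0^x(1-q^2\sin^2\theta)^{-1/2}\,d\theta$, $\mathrm{E}(x,q)=\int_0^x(1-q^2\sin^2\theta)^{1/2}\,d\theta$, $\mathrm{K}(q)=\mathrm{F}(\pi/2,q)$, $\mathrm{E}(q)=\mathrm{E}(\pi/2,q)$; $\mathrm{am}(\cdot,q)$ is the inverse of $x\mapsto\mathrm{F}(x,q)$, $\mathrm{cn}(x,q)=\cos\mathrm{am}(x,q)$. The function $q\mapsto2\mathrm{E}(q)-\mathrm{K}(q)$ is strictly decreasing on $[0,1)$ with unique zero $q_*\in(0,1)$. On $[1/\sqrt2,1)$ let $f(q)=(4q^4-5q^2+1)\mathrm{K}(q)+(-8q^4+8q^2-1)\mathrm{E}(q)$ and $g(q)=8(2\mathrm{E}(q)-\mathrm{K}(q))^2(2q^2-1)$. $f$ has a unique zero $\hat q\in[1/\sqrt2,1)$; $\hat\lambda:=g(\hat q)\approx0.70107$. $g(1/\sqrt2)=0$, $g$ is strictly increasing on $[1/\sqrt2,\hat q]$, strictly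 decreasing on $[\hat q,q_*]$ with $g(q_* )=0$, strictly increasing on $[q_*,1)$ with $g\to\infty$ at $1$. For $c\in(0,\hat\lambda]$ let $q_1(c)\in(1/\sqrt2,\hat q]$, $q_2(c)\in[\hat q,q_* )$ solve $g(q)=c$; for every $c>0$ let $q_3(c)\in(q_*,1)$ solve $g(q)=c$. Let $n_{\lambda,\ell}=\lceil\sqrt{\lambda\ell^2/\hat\lambda}\rceil$. Setting: $A_\ell=\{\gamma\in W^{2,2}(0,1;\mathbb{R}^2): |\gamma'|\neq0$ on $[0,1]$, $\gamma(0)=(0,0),\ \gamma(1)=(\ell,0)\}$; $\mathcal{E}_\lambda[\gamma]=\int_\gamma k^2\,ds+\lambda L[\gamma]$ ($k$ signed curvature, $L$ length). A penalized pinned elastica is $\gamma\in A_\ell$ with $\frac{d}{d\varepsilon}\mathcal{E}_\lambda[\gamma+\varepsilon\eta]|_{\varepsilon=0}=0$ for all $\eta\in W^{2,2}(0,1;\mathbb{R}^2)\cap W^{1,2}_0(0,1;\mathbb{R}^2)$. Local minimizer refers to the $W^{2,2}$-topology. Curves (arclength parametrized on $[0,2n\mathrm{K}(q)/\alpha]$): for $n\ge n_{\lambda,\ell}$, $\gamma_{\rm sarc}^{\lambda,\ell,n}(s)=\frac1\alpha\big(2\mathrm{E}(\mathrm{am}(\alpha s-\mathrm{K}(q),q),q)+2\mathrm{E}(q)-\alpha s,\ 2q\,\mathrm{cn}(\alpha s-\mathrm{K}(q),q)\big)$ with $q=q_1(\lambda\ell^2/n^2)$, $\alpha=\frac{2n}{\ell}(2\mathrm{E}(q)-\mathrm{K}(q))$;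 $\gamma_{\rm larc}^{\lambda,\ell,n}$ is the same formula with $q=q_2(\lambda\ell^2/n^2)$; for $n\ge1$, $\gamma_{\rm loop}^{\lambda,\ell,n}(s)=\frac1\alpha\big(-2\mathrm{E}(\mathrm{am}(\alpha s-\mathrm{K}(q),q),q)-2\mathrm{E}(q)+\alpha s,\ 2q\,\mathrm{cn}(\alpha s-\mathrm{K}(q),q)\big)$ with $q=q_3(\lambda\ell^2/n^2)$, $\alpha=\frac{2n}{\ell}(\mathrm{K}(q)-2\mathrm{E}(q))$. *)

(* Defs.v *)
From HB Require Import structures.
From mathcomp Require Import all_boot all_order all_algebra.
From mathcomp Require Import all_classical all_reals all_analysis.
Set Implicit Arguments. Unset Strict Implicit. Unset Printing Implicit Defensive.
Import Order.TTheory GRing.Theory Num.Theory.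
Import numFieldNormedType.Exports.
Local Open Scope classical_set_scope.
Local Open Scope ring_scope.

Section ElasticaDefs.
Variable R : realType.
Local Notation mu := (@lebesgue_measure R).

Definition oint (a b : R) (f : R -> R) : R :=
  if a <= b then \int[mu]_(x in `[a, b]) f x
  else - \int[mu]_(x in `[b, a]) f x.

Definition ellF (x q : R) : R :=
  oint 0 x (fun th => (Num.sqrt (1 - q ^+ 2 * (sin th) ^+ 2))^-1).
Definition ellE (x q : R) : R :=
  oint 0 x (fun th => Num.sqrt (1 - q ^+ 2 * (sin th) ^+ 2)).
Definition ellK (q : R) : R := ellF (pi / 2) q.
Definition ellEc (q : R) : R := ellE (pi / 2) q.

Definition am (x q : R) : R := xget 0 [set y | ellF y q = x].
Definition cn (x q : R) : R := cos (am x q).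

(** qstar : unique zero of 2E - K in (0,1) *)
Definition qstar : R := xget 0 [set q | 0 < q < 1 /\ 2 * ellEc q - ellK q = 0].

Definition fq (q : R) : R :=
  (4 * q ^+ 4 - 5 * q ^+ 2 + 1) * ellK q + (- 8 * q ^+ 4 + 8 * q ^+ 2 - 1) * ellEc q.
Definition gq (q : R) : R :=
  8 * (2 * ellEc q - ellK q) ^+ 2 * (2 * q ^+ 2 - 1).

(** \hat q : unique zero of f in [1/sqrt 2, 1);  \hat lambda = g(\hat q) *)
Definition qhat : R := xget 0 [set q | (Num.sqrt 2)^-1 <= q < 1 /\ fq q = 0].
Definition lamhat : R := gq qhat.

Definition q1 (c : R) : R := xget 0 [set q | (Num.sqrt 2)^-1 < q <= qhat /\ gq q = c].
Definition q2 (c : R) : R := xget 0 [set q | qhat <= q < qstar /\ gq q = c].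
Definition q3 (c : R) : R := xget 0 [set q | qstar < q < 1 /\ gq q = c].

Definition nlam (lam l : R) : int := Num.ceil (Num.sqrt (lam * l ^+ 2 / lamhat)).

Definition curve := R -> R * R.

Definition arc_curve (q al : R) : curve := fun s =>
  (al^-1 * (2 * ellE (am (al * s - ellK q) q) q + 2 * ellEc q - al * s),
   al^-1 * (2 * q * cn (al * s - ellK q) q)).
Definition loop_curve (q al : R) : curve := fun s =>
  (al^-1 * (- 2 * ellE (am (al * s - ellK q) q) q - 2 * ellEc q + al * s),
   al^-1 * (2 * q * cn (al * s - ellK q) q)).

Definition arc_alpha (n : nat) (l q : R) : R := 2 * n%:R / l * (2 * ellEc q - ellK q).
Definition loop_alpha (n : nat) (l q : R) : R := 2 * n%:R / l * (ellK q - 2 * ellEc q).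

Definition sarc_q (lam l : R) (n : nat) : R := q1 (lam * l ^+ 2 / (n%:R) ^+ 2).
Definition larc_q (lam l : R) (n : nat) : R := q2 (lam * l ^+ 2 / (n%:R) ^+ 2).
Definition loop_q (lam l : R) (n : nat) : R := q3 (lam * l ^+ 2 / (n%:R) ^+ 2).

Definition gamma_sarc (lam l : R) (n : nat) : curve :=
  arc_curve (sarc_q lam l n) (arc_alpha n l (sarc_q lam l n)).
Definition len_sarc (lam l : R) (n : nat) : R :=
  2 * n%:R * ellK (sarc_q lam l n) / arc_alpha n l (sarc_q lam l n).
Definition gamma_larc (lam l : R) (n : nat) : curve :=
  arc_curve (larc_q lam l n) (arc_alpha n l (larc_q lam l n)).
Definition len_larc (lam l : R) (n : nat) : R :=
  2 * n%:R * ellK (larc_q lam l n) / arc_alpha n l (larc_q lam l n).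
Definition gamma_loop (lam l : R) (n : nat) : curve :=
  loop_curve (loop_q lam l n) (loop_alpha n l (loop_q lam l n)).
Definition len_loop (lam l : R) (n : nat) : R :=
  2 * n%:R * ellK (loop_q lam l n) / loop_alpha n l (loop_q lam l n).

Definition eucl (p : R * R) : R := Num.sqrt (p.1 ^+ 2 + p.2 ^+ 2).

Definition L2 (g : R -> R) : Prop :=
  measurable_fun (`[0, 1] : set R) g /\ mu.-integrable `[0, 1] (fun t => ((g t) ^+ 2)%:E).

(** W^{2,2}(0,1;R^2) (1-d characterisation via the C^1 representative):
    gamma = gamma(0) + int_0^t v, with v continuous on [0,1] and
    v = v(0) + int_0^t g, g in L^2(0,1).  [W22rep gamma v] says that v is the
    (continuous representative of the) derivative of gamma. *)
Definition W22rep (gam v : curve) : Prop :=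
  exists g : curve,
    {within `[0, 1], continuous (fun t => (v t).1)} /\
    {within `[0, 1], continuous (fun t => (v t).2)} /\
    L2 (fun t => (g t).1) /\ L2 (fun t => (g t).2) /\
    (forall t, 0 <= t <= 1 ->
       (gam t).1 = (gam 0).1 + \int[mu]_(s in `[0, t]) (v s).1 /\
       (gam t).2 = (gam 0).2 + \int[mu]_(s in `[0, t]) (v s).2 /\
       (v t).1 = (v 0).1 + \int[mu]_(s in `[0, t]) (g s).1 /\
       (v t).2 = (v 0).2 + \int[mu]_(s in `[0, t]) (g s).2).

Definition W22 (gam : curve) : Prop := exists v, W22rep gam v.

Definition A_ell (l : R) (gam : curve) : Prop :=
  (exists v, W22rep gam v /\ forall t, 0 <= t <= 1 -> v t != (0, 0)) /\
  gam 0 = (0, 0) /\ gam 1 = (l, 0).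

(** first and second derivatives (classical; they agree a.e. on (0,1) with
    the weak derivatives of a W^{2,2} curve) *)
Definition vel (gam : curve) (t : R) : R * R :=
  (derive1 (fun s => (gam s).1) t, derive1 (fun s => (gam s).2) t).
Definition acc (gam : curve) (t : R) : R * R :=
  (derive1 (fun s => (vel gam s).1) t, derive1 (fun s => (vel gam s).2) t).

(** length L[gamma], elastic energy int_gamma k^2 ds and E_lambda *)
Definition len (gam : curve) : R := \int[mu]_(t in `[0, 1]) eucl (vel gam t).
Definition bending (gam : curve) : R :=
  \int[mu]_(t in `[0, 1])
     (((vel gam t).1 * (acc gam t).2 - (vel gam t).2 * (acc gam t).1) ^+ 2
       / (eucl (vel gam t)) ^+ 5).
Definition Elam (lam : R) (gam : curve) : R := bending gam + lam * len gam.

Definition cadd (g1 g2 : curve) : curve := fun t => ((g1 t).1 + (g2 t).1, (g1 t).2 + (g2 t).2).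
Definition cscale (e : R) (g : curve) : curve := fun t => (e * (g t).1, e * (g t).2).
Definition csub (g1 g2 : curve) : curve := cadd g1 (cscale (-1) g2).

Definition pinned_elastica (lam l : R) (gam : curve) : Prop :=
  A_ell l gam /\
  forall eta : curve, W22 eta -> eta 0 = (0, 0) -> eta 1 = (0, 0) ->
    is_derive (0 : R) (1 : R) (fun e : R => Elam lam (cadd gam (cscale e eta))) 0.

Definition W22norm (gam : curve) : R :=
  Num.sqrt (\int[mu]_(t in `[0, 1])
     ((eucl (gam t)) ^+ 2 + (eucl (vel gam t)) ^+ 2 + (eucl (acc gam t)) ^+ 2)).

Definition local_minimizer (lam l : R) (gam : curve) : Prop :=
  A_ell l gam /\
  exists delta : R, 0 < delta /\
    forall gam' : curve, A_ell l gam' -> W22norm (csub gam' gam) < delta ->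
      Elam lam gam <= Elam lam gam'.

Definition arclength_param_is (gam Gam : curve) (L : R) : Prop :=
  \int[mu]_(s in `[0, 1]) eucl (vel gam s) = L /\
  forall t, 0 <= t <= 1 -> gam t = Gam (\int[mu]_(s in `[0, t]) eucl (vel gam s)).

End ElasticaDefs.

(* Main.v *)
(* Between two zeros of its curvature, one period [T] apart, the elastica can be translated
   along itself: for small [eps] replace the piece over the arclength interval
   [[eps, T + eps]] by the translate of the piece over [[- eps, T - eps]].  The endpoints
   and tangents match because the tangent is even and [T]-periodic in arclength, and the
   energy does not change because the squared curvature is an affine function of the
   horizontal component of the tangent, so that the energy only depends on the length and
   on the span.  For [n >= 3] the cut [T + eps] lies inside the curve.  The new curve is
   W^{2,2}-close to the old one, but its curvature jumps at the two cuts, so it is not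
   critical: adding a small multiple of the vertical field [s * (L - s)] strictly lowers
   the energy. *)

(* With [kappa = - k * Y] the signed curvature, the first variation density in the direction of a
   vertical field [psi] is [G psi'' + G' psi'], where [G = 2 kappa x1]; on each smooth piece it
   integrates to boundary terms. [G] is odd and [T]-periodic, so it changes sign across both cuts,
   and since [psi'' = - 2] the values of [psi'] at the cuts differ by [2 T]: the jumps add up to
   [4 T G(eps)] instead of cancelling. As [G(0) = 0] and [G'(0)] is nonzero, arbitrarily small [eps]
   have [G(eps)] nonzero, and the sign of the multiple [t] of [psi] is chosen against it. What
   remains is quantitative: a remainder of order [t^2] whose constant does not depend on [eps], so
   that [t] can be fixed after [eps]. The second obstacle is regularity. Energy and norm are written
   with classical derivatives, which a [W^{2,2}] curve has only almost everywhere, and the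
   parametrization of the given curve is not by arclength. Curves are therefore carried together
   with chosen weak derivatives, and energies are compared through integrable upper bounds. *)
Require Import Defs.
From HB Require Import structures.
From mathcomp Require Import all_boot all_order all_algebra.
From mathcomp Require Import all_classical all_reals all_analysis.
From mathcomp Require Import measurable_realfun.
From mathcomp Require Import ring lra.
Import Order.TTheory GRing.Theory Num.Theory.
Import numFieldNormedType.Exports.
Local Open Scope classical_set_scope.
Local Open Scope ring_scope.
Set Implicit Arguments.
Unset Strict Implicit.
Unset Printing Implicit Defensive.

(** * Absolutely continuous functions on [[0, 1]] and almost everywhere comparison of integrals *)

Section AbsoluteContinuity.
Context {R : realType}.
Local Notation mu := (@lebesgue_measure R).
Implicit Types (F G f g : R -> R).

Definition integrable01 f := mu.-integrable `[0, 1] (EFin \o f).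

(** The weak derivative is a chosen function defined at every point, so that sums, products and
    cut-offs of [W^{1,1}] functions become explicit formulas for densities. *)
Definition ac F f := integrable01 f /\
  forall s u : R, 0 <= s -> s <= u -> u <= 1 -> F u - F s = \int[mu]_(x in `[s, u]) f x.

Lemma sub01 (s u : R) : 0 <= s -> u <= 1 -> `[s, u] `<=` (`[0, 1] : set R).
Proof. by move=> s0 u1; apply: subset_itv; rewrite bnd_simp. Qed.

Lemma integrable01S f (s u : R) : integrable01 f -> 0 <= s -> u <= 1 ->
  mu.-integrable `[s, u] (EFin \o f).
Proof. by move=> fi s0 u1; apply: integrableS fi => //; exact: sub01. Qed.

Lemma integral_cat f (a b c : R) : a <= b -> b <= c ->
  mu.-integrable `[a, c] (EFin \o f) ->
  \int[mu]_(x in `[a, c]) f x =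
  \int[mu]_(x in `[a, b]) f x + \int[mu]_(x in `[b, c]) f x.
Proof.
move=> ab bc fi; apply/eqP; rewrite addrC -subr_eq; apply/eqP.
rewrite Rintegral_itvB ?bnd_simp//.
rewrite Rintegral_itv_obnd_cbnd//.
by apply: integrableS fi => //; apply: subset_itv; rewrite bnd_simp.
Qed.

Lemma ac_from0 F f : integrable01 f ->
  (forall t : R, 0 <= t <= 1 -> F t = F 0 + \int[mu]_(x in `[0, t]) f x) -> ac F f.
Proof.
move=> fi FE; split=> // s u s0 su u1.
rewrite (FE u) ?(le_trans s0 su)// (FE s) ?s0 ?(le_trans su)//.
rewrite (integral_cat s0 su); last exact: integrable01S.
lra.
Qed.

Lemma acE0 F f : ac F f -> forall t : R, 0 <= t <= 1 ->
  F t = F 0 + \int[mu]_(x in `[0, t]) f x.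
Proof. by move=> [fi FE] t /andP[t0 t1]; rewrite -FE// subrKC. Qed.

Lemma eq_ac F1 f1 F2 f2 : (forall t : R, 0 <= t <= 1 -> F1 t = F2 t) ->
  (forall t : R, 0 <= t <= 1 -> f1 t = f2 t) -> ac F1 f1 -> ac F2 f2.
Proof.
move=> FE fE [fi acF]; split.
  apply: eq_integrable fi => // x; rewrite inE/= in_itv/= => x01.
  by rewrite fE.
move=> s u s0 su u1; rewrite -!FE ?s0 ?u1 ?(le_trans s0)//=; last exact: le_trans u1.
rewrite acF//; apply: eq_Rintegral => x; rewrite inE/= in_itv/= => /andP[sx xu].
by rewrite fE// (le_trans s0)//= (le_trans xu).
Qed.

Lemma acD F f G g : ac F f -> ac G g -> ac (fun x => F x + G x) (fun x => f x + g x).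
Proof.
move=> [fi acF] [gi acG]; split.
  by apply: eq_integrable (integrableD _ fi gi) => // x _.
move=> s u s0 su u1; rewrite RintegralD//; [|exact: integrable01S..].
by rewrite -acF// -acG//; lra.
Qed.

Lemma acZ c F f : ac F f -> ac (fun x => c * F x) (fun x => c * f x).
Proof.
move=> [fi acF]; split.
  by apply: eq_integrable (integrableZl _ c fi) => // x _.
move=> s u s0 su u1; rewrite RintegralZl//; last exact: integrable01S.
by rewrite -acF//; lra.
Qed.

Lemma within_integrable01 f : {within `[0, 1], continuous f} -> integrable01 f.
Proof. by move=> cf; apply: continuous_compact_integrable => //; exact: segment_compact. Qed.

Lemma within01M f g : {within `[0, 1], continuous f} -> {within `[0, 1], continuous g} ->
  {within `[0, 1], continuous (fun u => f u * g u)}.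
Proof. by move=> cf cg u; apply: cvgM; [exact: cf|exact: cg]. Qed.

Lemma within01N f : {within `[0, 1], continuous f} ->
  {within `[0, 1], continuous (fun u => - f u)}.
Proof. by move=> cf u; apply: cvgN; exact: cf. Qed.

Lemma within01C (c : R) : {within `[0, 1], continuous (fun _ : R => c)}.
Proof. by move=> u; exact: cvg_cst. Qed.

Lemma ac_smooth F f : {within `[0, 1], continuous f} -> {within `[0, 1], continuous F} ->
  (forall x : R, 0 < x < 1 -> is_derive x 1 F (f x)) -> ac F f.
Proof.
move=> cf cF dF; split; first exact: within_integrable01.
move=> s u s0; rewrite le_eqVlt => /predU1P[<- _|su u1].
  by rewrite subrr set_itv1 Rintegral_set1.
have sub := sub01 s0 u1.
have cFsu : {within `[s, u], continuous F} by exact: continuous_subspaceW cF.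
have [_ cl cr] := (continuous_within_itvP _ su).1 cFsu.
rewrite /Rintegral (@continuous_FTC2 _ f F)//.
- exact: continuous_subspaceW cf.
- split=> // x; rewrite in_itv/= => /andP[sx xu].
  by apply: ex_derive; apply: dF; rewrite (le_lt_trans s0)//= (lt_le_trans xu).
- move=> x; rewrite in_itv/= => /andP[sx xu].
  rewrite derive1E; apply: derive_val; apply: dF.
  by rewrite (le_lt_trans s0)//= (lt_le_trans xu).
Qed.

Lemma ac_continuous F f : ac F f -> {within `[0, 1], continuous F}.
Proof.
move=> acF; have [fi _] := acF.
have c := parameterized_integral_continuous (ler01 : 0 <= 1 :> R) fi.
have: {within `[0, 1], continuous (fun t : R => F 0 + parameterized_integral mu 0 t f)}.
  by move=> x; apply: cvgD; [exact: cvg_cst|exact: c].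
apply: subspace_eq_continuous => x /set_mem/=; rewrite in_itv/= => x01.
exact/esym/(acE0 acF x01).
Qed.

Lemma itv01_near (x : R) : 0 < x < 1 -> \forall t \near x, 0 < t < 1.
Proof.
move=> /andP[x0 x1]; near=> t; apply/andP; split; near: t.
  exact: (cvgr_gt x).
exact: (cvgr_lt x).
Unshelve. all: by end_near. Qed.

Lemma near_is_derive F G (x l : R) : (\forall t \near x, F t = G t) ->
  is_derive x 1 F l -> is_derive x 1 G l.
Proof.
move=> FG dF; by apply: near_eq_is_derive dF; apply: filterS FG => t ->.
Qed.

Lemma ac_derive F f : ac F f -> {within `[0, 1], continuous f} ->
  forall x : R, 0 < x < 1 -> is_derive x 1 F (f x).
Proof.
move=> acF cf x x01; have [fi _] := acF; have /andP[x0 x1] := x01.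
have [cfo _ _] := (continuous_within_itvP _ ltr01).1 cf.
have [|dG GE] := continuous_FTC1_closed x1 fi x0.
  by apply: cfo; rewrite in_itv/= x0 x1.
apply: (@near_is_derive (fun t : R => F 0 + \int[mu]_(y in `[0, t]) f y)).
  near=> t.
  have /andP[t0 t1] : 0 < t < 1 by near: t; exact: itv01_near.
  by rewrite [in RHS](acE0 acF) ?(ltW t0) ?ltW.
rewrite -[X in is_derive _ _ _ X]add0r; apply: is_deriveD.
by rewrite -GE derive1E; apply: derivableP.
Unshelve. all: by end_near. Qed.

(** Lebesgue differentiation, applied to the density extended by zero to the whole line; inside the
    open interval the extension changes nothing. *)
Lemma ac_ae_derive F f : ac F f ->
  {ae mu, forall x : R, 0 < x < 1 -> is_derive x 1 F (f x)}.
Proof.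
move=> acF; have [fi _] := acF.
have locf : locally_integrable setT (f \_ `[0, 1]) by exact: integrable_locally.
move: (lebesgue_differentiation locf).
apply: filterS; first exact: (ae_filter_ringOfSetsType mu).
move=> x lx x01; have /andP[x0 x1] := x01.
have fi' : mu.-integrable `[0, 1] (EFin \o (f \_ `[0, 1])).
  apply: eq_integrable fi => // y y01 /=.
  by rewrite patchE y01.
have [dG GE] := FTC1_lebesgue_pt x1 fi' ltac:(by rewrite /= lte_fin) lx.
apply: (@near_is_derive (fun t : R => F 0 + \int[mu]_(y in `[0, t]) (f \_ `[0, 1]) y)).
  near=> t.
  have /andP[t0 t1] : 0 < t < 1 by near: t; exact: itv01_near.
  rewrite [in RHS](acE0 acF) ?(ltW t0) ?ltW//; congr (_ + _).
  apply: eq_Rintegral => y; rewrite inE/= in_itv/= => /andP[y0 yt].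
  by rewrite patchE mem_set//= in_itv/= y0/= (le_trans yt)// ltW.
rewrite -[X in is_derive _ _ _ X]add0r; apply: is_deriveD.
have -> : f x = (f \_ `[0, 1]) x.
  by rewrite patchE mem_set//= in_itv/= !ltW.
by rewrite -GE derive1E; apply: derivableP.
Unshelve. all: by end_near. Qed.


Lemma ac_bounded F f : ac F f -> exists M : R, forall t : R, 0 <= t <= 1 -> `|F t| <= M.
Proof.
move=> acF; have cF := ac_continuous acF.
have [M [_ HM]] := compact_bounded (continuous_compact cF (@segment_compact R 0 1)).
exists (M + 1) => t t01; apply: HM; first by rewrite ltrDl.
by exists t => //=; rewrite in_itv.
Qed.

Lemma within_measurable01 f : {within `[0, 1], continuous f} ->
  measurable_fun (`[0, 1] : set R) f.
Proof. by move=> cf; apply: subspace_continuous_measurable_fun => //. Qed.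

Lemma integrable01M f g (M : R) : measurable_fun (`[0, 1] : set R) g ->
  (forall t : R, 0 <= t <= 1 -> `|g t| <= M) -> integrable01 f ->
  integrable01 (fun x => f x * g x).
Proof.
move=> mg gM fi.
have bg : [bounded g x | x in `[0, 1]].
  exists M; split; first exact: num_real.
  move=> r Mr x; rewrite /= in_itv/= => x01.
  by rewrite (le_trans (gM _ x01))// ltW.
by apply: eq_integrable (integrableMl _ fi mg bg) => // x _.
Qed.

(** Absolute continuity of the integral supplies one [d] for all subintervals, although [f] may be
    unbounded. *)
Lemma ac_unif F f : ac F f -> forall e : R, 0 < e -> exists2 d : R, 0 < d &
  forall s u : R, 0 <= s -> s <= u -> u <= 1 -> u - s < d -> `|F u - F s| <= e.
Proof.
move=> [fi acF] e e0.
have fi' : mu.-integrable setT (EFin \o (f \_ `[0, 1])).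
  by rewrite -restrict_EFin; apply/integrable_restrict => //=; rewrite setTI.
have [d [d0 H]] : exists d : R, 0 < d /\ forall A, measurable A ->
    (mu A < d%:E)%E -> \int[mu]_(x in A) `|(f \_ `[0, 1]) x| < e.
  exact: integral_normr_continuous.
exists d => // s u s0 su u1 usd.
rewrite acF// (le_trans (le_normr_Rintegral _ _))//.
  exact: integrable01S.
have -> : \int[mu]_(t in `[s, u]) `|f t| = \int[mu]_(t in `[s, u]) `|(f \_ `[0, 1]) t|.
  apply: eq_Rintegral => t tsu; rewrite patchE mem_set//.
  by apply: (sub01 s0 u1); exact: set_mem.
apply/ltW/H => //.
rewrite lebesgue_measure_itv/= lte_fin; by case: ifPn.
Qed.

(** Telescoping over equal steps shorter than [d] gives [|K u - K s| <= e * (V u - V s)] for every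
    [e]. This stands in for the argument that an absolutely continuous function with derivative zero
    almost everywhere is constant. *)
Lemma grid_const (K V : R -> R) (s u : R) : s <= u ->
  (forall e : R, 0 < e -> exists2 d : R, 0 < d & forall x y : R,
     s <= x -> x <= y -> y <= u -> y - x < d -> `|K y - K x| <= e * (V y - V x)) ->
  K u = K s.
Proof.
move=> su H.
have main (e : R) : 0 < e -> `|K u - K s| <= e * (V u - V s).
  move=> e0; have [d d0 Hd] := H e e0.
  pose N := (Num.truncn ((u - s) / d)).+1.
  have N0 : 0 < N%:R :> R by rewrite ltr0n.
  pose h := (u - s) / N%:R.
  have h0 : 0 <= h by rewrite divr_ge0// ?subr_ge0// ltW.
  have hd : h < d.
    rewrite /h ltr_pdivrMr// mulrC -ltr_pdivrMr//.
    by rewrite /N truncnS_gt.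
  have hN : s + h * N%:R = u by rewrite /h divfK ?gt_eqF// subrKC.
  have step (k : nat) : (k <= N)%N ->
      `|K (s + h * k%:R) - K s| <= e * (V (s + h * k%:R) - V s).
    elim: k => [_|k IH kN]; first by rewrite mulr0 addr0 !subrr mulr0 normr0.
    have := IH (ltnW kN).
    have hk : s + h * k.+1%:R <= u.
      by rewrite -hN lerD2l ler_wpM2l// ler_nat.
    have : `|K (s + h * k.+1%:R) - K (s + h * k%:R)| <=
        e * (V (s + h * k.+1%:R) - V (s + h * k%:R)).
      apply: Hd => //.
      - by rewrite lerDl mulr_ge0.
      - by rewrite lerD2l ler_wpM2l// ler_nat.
      - by rewrite opprD addrACA subrr add0r -mulrBr -natrB// subSnn mulr1.
    move=> h1 h2.
    rewrite (_ : K _ - K s = (K (s + h * k.+1%:R) - K (s + h * k%:R)) +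
       (K (s + h * k%:R) - K s)); last by rewrite addrA subrK.
    apply: (le_trans (ler_normD _ _)); apply: le_trans (lerD h1 h2) _.
    by rewrite -mulrDr addrA subrK.
  by have := step N (leqnn _); rewrite hN.
apply/eqP; rewrite -subr_eq0 -normr_le0.
apply/ler_addgt0Pr => e e0; rewrite add0r.
have W0 : 0 <= V u - V s.
  have := main 1 ltr01; rewrite mul1r; apply: le_trans; exact: normr_ge0.
have W1 : 0 < V u - V s + 1 by rewrite ltr_wpDl.
have eW : 0 < e / (V u - V s + 1) by rewrite divr_gt0.
apply: le_trans (main _ eW) _.
by rewrite -mulrA ger_pMr// mulrC ler_pdivrMr// mul1r lerDl.
Qed.

(** On a short interval [[x, y]] the defect of the product rule is the integral of
    [f t * (G y - G t) + g t * (F x - F t)]. Uniform smallness of the increments of [F] and [G]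
    bounds it by [e] times the integral of [|f| + |g|], and [grid_const] concludes. *)
Lemma acM F f G g : ac F f -> ac G g ->
  ac (fun x => F x * G x) (fun x => f x * G x + g x * F x).
Proof.
move=> acF acG; have [fi FE] := acF; have [gi GE] := acG.
have [MF HF] := ac_bounded acF; have [MG HG] := ac_bounded acG.
have fGi := integrable01M (within_measurable01 (ac_continuous acG)) HG fi.
have gFi := integrable01M (within_measurable01 (ac_continuous acF)) HF gi.
have hi : integrable01 (fun x => f x * G x + g x * F x).
  by apply: eq_integrable (integrableD _ fGi gFi) => // x _.
split=> // s u s0 su u1.
pose h x := f x * G x + g x * F x.
pose w x := `|f x| + `|g x|.
have wi : integrable01 w.
  by apply: eq_integrable (integrableD _ (integrable_norm fi) (integrable_norm gi)) => // x _.
pose K t := F t * G t - \int[mu]_(x in `[s, t]) h x.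
pose V t := \int[mu]_(x in `[s, t]) w x.
suff : K u = K s.
  by rewrite /K set_itv1 Rintegral_set1 subr0 => <-; rewrite subKr.
apply: (@grid_const K V) => // e e0.
have [d1 d10 H1] := ac_unif acF e0.
have [d2 d20 H2] := ac_unif acG e0.
exists (Num.min d1 d2) => [|x y sx xy yu]; first by rewrite lt_min d10 d20.
rewrite lt_min => /andP[xy1 xy2].
have x0 : 0 <= x by exact: le_trans sx.
have y1 : y <= 1 by exact: le_trans u1.
have -> : V y - V x = \int[mu]_(t in `[x, y]) w t.
  rewrite /V (integral_cat sx xy); last exact: integrable01S.
  by rewrite addrC addKr.
have -> : K y - K x = \int[mu]_(t in `[x, y]) (f t * (G y - G t) + g t * (F x - F t)).
  rewrite /K (integral_cat sx xy); last exact: integrable01S.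
  have -> : \int[mu]_(t in `[x, y]) (f t * (G y - G t) + g t * (F x - F t)) =
      \int[mu]_(t in `[x, y]) ((G y * f t + F x * g t) - h t).
    by apply: eq_Rintegral => t _; rewrite /h; ring.
  have i1 : mu.-integrable `[x, y] (EFin \o (fun t => G y * f t)).
    by apply: eq_integrable (integrableZl _ (G y) (integrable01S fi x0 y1)) => // t _.
  have i2 : mu.-integrable `[x, y] (EFin \o (fun t => F x * g t)).
    by apply: eq_integrable (integrableZl _ (F x) (integrable01S gi x0 y1)) => // t _.
  rewrite RintegralB//; first last.
  - exact: integrable01S.
  - by apply: eq_integrable (integrableD _ i1 i2) => // t _.
  rewrite (RintegralD _ i1 i2)// RintegralZl//; last exact: integrable01S.
  rewrite RintegralZl//; last exact: integrable01S.
  rewrite -FE// -GE//; ring.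
have ki : integrable01 (fun t => f t * (G y - G t) + g t * (F x - F t)).
  have i1 : integrable01 (fun t => G y * f t).
    by apply: eq_integrable (integrableZl _ (G y) fi) => // t _.
  have i2 : integrable01 (fun t => F x * g t).
    by apply: eq_integrable (integrableZl _ (F x) gi) => // t _.
  apply: eq_integrable (integrableB _ (integrableD _ i1 i2) hi) => // t _ /=.
  by rewrite -!EFinD; congr EFin; ring.
apply: (le_trans (le_normr_Rintegral _ _)) => //; first exact: integrable01S.
rewrite -RintegralZl//; last exact: integrable01S.
apply: le_Rintegral => //.
- exact: integrable_norm (integrable01S ki _ _).
- by apply: eq_integrable (integrableZl _ e (integrable01S wi x0 y1)) => // t _.
move=> t; rewrite /= in_itv/= => /andP[xt ty].
rewrite (le_trans (ler_normD _ _))// !normrM /w mulrDr ![e * _]mulrC.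
rewrite lerD// ler_wpM2l//.
  by apply: H2 => //; [exact: le_trans xt|rewrite (le_lt_trans _ xy2)// lerD2l lerN2].
rewrite distrC; apply: H1 => //; first exact: le_trans y1.
by rewrite (le_lt_trans _ xy1)// lerD2r.
Qed.

Definition clamp (a b x : R) : R := Num.max a (Num.min x b).

Lemma clamp_in (a b x : R) : a <= b -> a <= clamp a b x <= b.
Proof. by move=> ab; rewrite /clamp le_max lexx ge_max ab ge_min lexx orbT. Qed.

Lemma clamp_id (a b x : R) : a <= x <= b -> clamp a b x = x.
Proof. by move=> /andP[ax xb]; rewrite /clamp (min_idPl xb) (max_idPr ax). Qed.

Lemma clamp_le (a b x : R) : a <= b -> x <= a -> clamp a b x = a.
Proof. by move=> ab xa; rewrite /clamp (min_idPl (le_trans xa ab)) (max_idPl xa). Qed.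

Lemma clamp_ge (a b x : R) : a <= b -> b <= x -> clamp a b x = b.
Proof. by move=> ab bx; rewrite /clamp (min_idPr bx) (max_idPr ab). Qed.

Lemma clamp_mono (a b x y : R) : x <= y -> clamp a b x <= clamp a b y.
Proof. move=> xy; rewrite /clamp ge_max le_max lexx/= le_max; apply/orP; right.
by rewrite le_min !ge_min xy lexx orbT. Qed.

(** Freezing [F] outside [[a, b]] leaves it continuous and only erases its density there.
    Modifications located between two cuts are obtained this way without gluing pieces. *)
Lemma ac_clamp (a b : R) F f : 0 <= a -> a <= b -> b <= 1 -> ac F f ->
  ac (fun x => F (clamp a b x)) (fun x => (f \_ `[a, b]) x).
Proof.
move=> a0 ab b1 [fi FE].
have subab := sub01 a0 b1.
have fabi : integrable01 (f \_ `[a, b]).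
  rewrite /integrable01 -restrict_EFin; apply/integrable_restrict => //.
  by rewrite setIidr//; exact: integrableS fi.
split=> // s u s0 su u1.
have /andP[as_ sb] := clamp_in s ab.
have /andP[au ub] := clamp_in u ab.
have cm := clamp_mono a b su.
rewrite FE//; [|exact: le_trans a0 _|exact: le_trans b1].
rewrite -Rintegral_mkcondr.
(* If [[s, u]] misses [[a, b]], both clamped values coincide and the intersection is empty;
   otherwise the interval between the clamped values is exactly the intersection. *)
have [ua|ua] := ltP u a.
  rewrite (clamp_le ab (ltW ua)) (clamp_le ab (le_trans su (ltW ua))).
  rewrite set_itv1 Rintegral_set1.
  rewrite (_ : _ `&` _ = set0) ?Rintegral_set0//.
  rewrite -subset0 => x [/=]; rewrite !in_itv/= => /andP[_ xu] /andP[ax _].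
  by have := le_lt_trans (le_trans ax xu) ua; rewrite ltxx.
have [bs|bs] := ltP b s.
  rewrite (clamp_ge ab (ltW bs)) (clamp_ge ab (le_trans (ltW bs) su)).
  rewrite set_itv1 Rintegral_set1.
  rewrite (_ : _ `&` _ = set0) ?Rintegral_set0//.
  rewrite -subset0 => x [/=]; rewrite !in_itv/= => /andP[sx _] /andP[_ xb].
  by have := lt_le_trans bs (le_trans sx xb); rewrite ltxx.
congr Rintegral; apply/seteqP; split => x /=; rewrite !in_itv/=.
  move=> /andP[]; rewrite /clamp ge_max le_max le_min => /andP[ax].
  rewrite ge_min => /orP[sx|bx]; last first.
    by move=> /orP[|/andP[]]; lra.
  by move=> /orP[|/andP[]]; lra.
move=> [/andP[sx xu] /andP[ax xb]].
by rewrite /clamp ge_max ax ge_min sx/= le_max le_min xu xb orbT.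
Qed.

(** A continuous density makes [F] classically differentiable inside the interval, so the ordinary
    chain rule and the fundamental theorem apply. *)
Lemma ac_comp (G G1 F f : R -> R) :
  (forall x : R, is_derive x 1 G (G1 x)) -> continuous G1 ->
  ac F f -> {within `[0, 1], continuous f} ->
  ac (fun x => G (F x)) (fun x => G1 (F x) * f x).
Proof.
move=> dG cG1 acF cf.
have cG : continuous G.
  by move=> x; apply/differentiable_continuous/derivable1_diffP; case: (dG x).
have cF := ac_continuous acF.
apply: ac_smooth.
- move=> x; apply: cvgM; last exact: cf.
  by apply: (@cvg_comp _ _ _ F G1); [exact: cF|exact: cG1].
- move=> x.
  by apply: (@cvg_comp _ _ _ F G); [exact: cF|exact: cG].
- move=> x x01; have dF := ac_derive acF cf x01.
  exact: is_derive1_comp.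
Qed.


Import HBNNSimple.

(** Neither [f] nor [g] need be measurable: Lebesgue measure is not complete here,
    and classical derivatives are only controlled almost everywhere. *)
Lemma ge0_ae_le_integral (D : set R) (f g : R -> \bar R) : measurable D ->
  (forall x, D x -> (0 <= f x)%E) -> (forall x, D x -> (0 <= g x)%E) ->
  {ae mu, forall x, D x -> (f x <= g x)%E} ->
  (\int[mu]_(x in D) f x <= \int[mu]_(x in D) g x)%E.
Proof.
move=> mD f0 g0 [N [mN N0 sN]].
rewrite ge0_integralE//; apply: ge_ereal_sup => _ [h /= hf <-].
have mNC : measurable (~` N) by exact: measurableC.
(* The simple function [h] below [f] is set to zero on the null set [N]. Its integral is unchanged,
   and it now lies below [g] everywhere, hence enters the supremum defining the integral of [g]. *)
have -> : sintegral mu h = (\int[mu]_x (proj_nnsfun h mNC x)%:E)%E.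
  rewrite -[sintegral mu h](_ : (\int[mu]_x (h x)%:E)%E = _); last first.
    by rewrite integral_nnsfun// patch_setT.
  rewrite (ge0_negligible_integral mN)//; last first.
  - by move=> x _; rewrite lee_fin.
  - exact/measurable_EFinP.
  rewrite setTD integral_mkcond restrict_EFin.
  by apply: eq_integral => x _; rewrite -mrestrict.
rewrite integral_nnsfun// patch_setT ge0_integralE//.
apply: ereal_sup_ubound; exists (proj_nnsfun h mNC) => //= x.
rewrite -[X in (X%:E <= _)%E]/(proj_nnsfun h mNC x) -mrestrict !patchE.
have gD0 : (0 <= (g \_ D) x)%E.
  by rewrite patchE; case: ifPn => // /set_mem; exact: g0.
case: ifPn => xN; last by rewrite -patchE.
have := hf x; rewrite patchE; case: ifPn => // xD /le_trans; apply.
apply: contrapT => fg; move/set_mem: xN; apply; apply: sN => /=.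
by apply: contra_not fg; apply; exact: set_mem.
Qed.

Lemma ge0_ae_le_Rintegral (D : set R) (f g : R -> R) : measurable D ->
  (forall x, D x -> 0 <= f x) -> (forall x, D x -> 0 <= g x) ->
  mu.-integrable D (EFin \o g) -> {ae mu, forall x, D x -> f x <= g x} ->
  \int[mu]_(x in D) f x <= \int[mu]_(x in D) g x.
Proof.
move=> mD f0 g0 gi fg.
have h : (\int[mu]_(x in D) (f x)%:E <= \int[mu]_(x in D) (g x)%:E)%E.
  exact: ge0_ae_le_integral.
have gfin : (\int[mu]_(x in D) (g x)%:E)%E \is a fin_num by exact: integrable_fin_num.
apply: fine_le => //; rewrite ge0_fin_numE.
  by apply: le_lt_trans h _; rewrite ltey_eq gfin.
by apply: integral_ge0 => x /f0; rewrite lee_fin.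
Qed.

Lemma ge0_ae_eq_Rintegral (D : set R) (f g : R -> R) : measurable D ->
  (forall x, D x -> 0 <= f x) -> (forall x, D x -> 0 <= g x) ->
  {ae mu, forall x, D x -> f x = g x} ->
  \int[mu]_(x in D) f x = \int[mu]_(x in D) g x.
Proof.
move=> mD f0 g0 fg; congr fine; apply/eqP; rewrite eq_le; apply/andP; split.
  apply: ge0_ae_le_integral => //.
  by apply: (@filterS _ _ (ae_filter_ringOfSetsType mu)) fg => x /[apply] ->.
apply: ge0_ae_le_integral => //.
by apply: (@filterS _ _ (ae_filter_ringOfSetsType mu)) fg => x /[apply] ->.
Qed.

Lemma ae_interior01 : {ae mu, forall x : R, 0 <= x <= 1 -> 0 < x < 1}.
Proof.
exists [set 0; 1]; split; first exact: measurableU.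
  apply/eqP; rewrite -measure_le0 (le_trans (measureU2 _ _ _))//.
  by rewrite [X in (X + _)%E]lebesgue_measure_set1 [X in (_ + X)%E]lebesgue_measure_set1 adde0.
move=> x /=; apply: contra_notP => /not_orP[x0 x1] /andP[x0' x1'].
by rewrite !lt_neqAle x0' x1' !andbT; apply/andP; split; apply/eqP => // /esym.
Qed.

Lemma continuous_eq01 f g : {within `[0, 1], continuous f} ->
  {within `[0, 1], continuous g} -> (forall x : R, 0 < x < 1 -> f x = g x) ->
  forall x : R, 0 <= x <= 1 -> f x = g x.
Proof.
move=> cf cg fg x /andP[]; rewrite le_eqVlt => /predU1P[<- _|x0].
  have [_ f0 _] := (continuous_within_itvP _ ltr01).1 cf.
  have [_ g0 _] := (continuous_within_itvP _ ltr01).1 cg.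
  apply: (@cvg_unique _ _ (f @ 0^'+)) => //.
  apply: cvg_trans g0; apply: near_eq_cvg; near=> y; apply/esym/fg.
  by apply/andP; split; near: y; [exact: nbhs_right_gt|exact: nbhs_right_lt].
rewrite le_eqVlt => /predU1P[->|x1]; last by apply: fg; rewrite x0.
have [_ _ f1] := (continuous_within_itvP _ ltr01).1 cf.
have [_ _ g1] := (continuous_within_itvP _ ltr01).1 cg.
apply: (@cvg_unique _ _ (f @ 1^'-)) => //.
apply: cvg_trans g1; apply: near_eq_cvg; near=> y; apply/esym/fg.
by apply/andP; split; near: y; [exact: nbhs_left_gt|exact: nbhs_left_lt].
Unshelve. all: by end_near. Qed.

Lemma L2_integrable f : L2 f -> integrable01 f.
Proof.
move=> [mf f2].
have i1 : integrable01 (fun=> 1).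
  by apply: within_integrable01; apply: continuous_subspaceT => x; exact: cvg_cst.
apply: le_integrable (integrableD _ i1 f2) => //=.
  exact/measurable_EFinP.
move=> x _ /=; rewrite lee_fin [leRHS]ger0_norm ?addr_ge0 ?sqr_ge0//.
have := sqr_ge0 (`|f x| - 1).
rewrite -[f x ^+ 2]real_normK ?num_real//; nra.
Qed.

Lemma L2D f g : L2 f -> L2 g -> L2 (fun x => f x + g x).
Proof.
move=> [mf f2] [mg g2]; split; first exact: measurable_funD.
have i : mu.-integrable `[0, 1] (fun x => 2%:E * ((f x ^+ 2)%:E + (g x ^+ 2)%:E))%E.
  by apply: integrableZl => //; exact: integrableD.
apply: le_integrable i => //=.
  by apply/measurable_EFinP; apply: measurable_funX; exact: measurable_funD.
move=> x _; rewrite /= lee_fin !ger0_norm ?sqr_ge0//; last first.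
  by apply: mulr_ge0 => //; apply: addr_ge0; exact: sqr_ge0.
have := sqr_ge0 (f x - g x); nra.
Qed.

Lemma L2M f g (M : R) : measurable_fun (`[0, 1] : set R) g ->
  (forall t : R, 0 <= t <= 1 -> `|g t| <= M) -> L2 f -> L2 (fun x => f x * g x).
Proof.
move=> mg gM [mf f2]; split; first exact: measurable_funM.
have i : integrable01 (fun x => f x ^+ 2 * g x ^+ 2).
  apply: (@integrable01M _ _ (M ^+ 2)) => //; first exact: measurable_funX.
  by move=> t /gM gt; rewrite normrX ler_pXn2r// ?nnegrE ?(le_trans _ gt).
by apply: eq_integrable i => // x _ /=; rewrite exprMn.
Qed.

Lemma L2_bounded f (M : R) : measurable_fun (`[0, 1] : set R) f ->
  (forall t : R, 0 <= t <= 1 -> `|f t| <= M) -> L2 f.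
Proof.
move=> mf fM; have L1 : L2 ((fun=> 1) : R -> R).
  split=> //; apply: within_integrable01; apply: continuous_subspaceT => x.
  exact: cvg_cst.
have [mf' f2] := L2M mf fM L1; split=> //.
by apply: eq_integrable f2 => // x _; rewrite mul1r.
Qed.

Lemma bounded_within f : {within `[0, 1], continuous f} ->
  exists M : R, forall t : R, 0 <= t <= 1 -> `|f t| <= M.
Proof.
move=> cF.
have [M [_ HM]] := compact_bounded (continuous_compact cF (@segment_compact R 0 1)).
exists (M + 1) => t t01; apply: HM; first by rewrite ltrDl.
by exists t => //=; rewrite in_itv.
Qed.

End AbsoluteContinuity.

(** * Incomplete elliptic integrals and the amplitude function *)

Section EllipticFunctions.
Context {R : realType}.
Local Notation mu := (@lebesgue_measure R).

Lemma continuous_integrable (f : R -> R) (a b : R) : continuous f ->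
  mu.-integrable `[a, b] (EFin \o f).
Proof.
move=> cf; apply: continuous_compact_integrable; first exact: segment_compact.
exact: continuous_subspaceT.
Qed.

(** Moving the base point to some [N] left of both [0] and [x] merges the two orientations of [oint]
    into one formula near [x]: an ordinary integral from [N] minus a constant. *)
Lemma is_derive_oint (f : R -> R) (x : R) : continuous f ->
  is_derive x 1 (fun y => oint 0 y f) (f x).
Proof.
move=> cf; pose N := - (`|x| + 1).
have N0 : N < 0 by rewrite oppr_lt0 ltr_wpDl.
have Nx : N < x.
  rewrite /N ltrNl; apply: (@le_lt_trans _ _ `|x|); last by rewrite ltrDl.
  by rewrite -normrN ler_norm.
have x1 : x < x + 1 by rewrite ltrDl.
have [dG GE] := continuous_FTC1_closed x1 (continuous_integrable N (x + 1) cf) Nx (cf x).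
apply: (@near_is_derive _ (fun y => - (\int[mu]_(t in `[N, 0]) f t) + \int[mu]_(t in `[N, y]) f t)).
  near=> y; rewrite /oint.
  have Ny : N <= y by apply: ltW; near: y; exact: (cvgr_gt x).
  case: ifPn => [y0|]; last rewrite -ltNge => y0.
    by rewrite (integral_cat (ltW N0) y0 (continuous_integrable _ _ cf)) addrA addNr add0r.
  rewrite (integral_cat Ny (ltW y0) (continuous_integrable _ _ cf)).
  by rewrite opprD addrAC addNr add0r.
rewrite -[X in is_derive _ _ _ X]add0r; apply: is_deriveD.
by rewrite -GE derive1E; apply: derivableP.
Unshelve. all: by end_near. Qed.

Lemma is_derive_continuous (F f : R -> R) : (forall x : R, is_derive x 1 F (f x)) -> continuous F.
Proof. by move=> dF x; apply/differentiable_continuous/derivable1_diffP; case: (dF x). Qed.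

Lemma is_derive1_shift (F : R -> R) (c x l : R) : is_derive (x + c) 1 F l ->
  is_derive x 1 (fun y => F (y + c)) l.
Proof.
move=> dF; rewrite -[l]mulr1; apply: is_derive1_comp.
by apply: is_derive_eq (is_deriveD _ _) _; rewrite addr0.
Qed.

Lemma is_derive1_reflect (F : R -> R) (x l : R) : is_derive (- x) 1 F l ->
  is_derive x 1 (fun y => F (- y)) (- l).
Proof. by move=> dF; rewrite -[l]mulr1 -mulrN; apply: is_derive1_comp. Qed.

Variable q : R.
Hypothesis q01 : 0 <= q < 1.

Definition dn2 (th : R) : R := 1 - q ^+ 2 * sin th ^+ 2.

Lemma sqr_q_lt1 : q ^+ 2 < 1.
Proof. by move: q01 => /andP[q0 q1]; rewrite expr2; nra. Qed.

Lemma sin2_le1 (th : R) : 0 <= sin th ^+ 2 <= 1.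
Proof. by rewrite sqr_ge0/= sin2cos2 lerBlDr lerDl sqr_ge0. Qed.

Lemma dn2_ge (th : R) : 1 - q ^+ 2 <= dn2 th.
Proof.
rewrite /dn2; have := sqr_ge0 q; have /andP[] := sin2_le1 th; nra.
Qed.

Lemma dn2_gt0 (th : R) : 0 < dn2 th.
Proof. by apply: lt_le_trans (dn2_ge th); rewrite subr_gt0 sqr_q_lt1. Qed.

Lemma dn2_le1 (th : R) : dn2 th <= 1.
Proof. by rewrite /dn2 lerBlDr lerDl mulr_ge0 ?sqr_ge0. Qed.

Definition dn (th : R) : R := Num.sqrt (dn2 th).

Lemma dn_gt0 (th : R) : 0 < dn th. Proof. by rewrite sqrtr_gt0 dn2_gt0. Qed.

Lemma dn_le1 (th : R) : dn th <= 1.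
Proof. by rewrite -[leRHS]sqrtr1 ler_sqrt// dn2_le1. Qed.

Lemma sqr_dn (th : R) : dn th ^+ 2 = dn2 th.
Proof. by rewrite sqr_sqrtr// ltW// dn2_gt0. Qed.

Lemma is_derive_dn (th : R) :
  is_derive th 1 dn (- (q ^+ 2 * sin th * cos th / dn th)).
Proof.
have d1 : is_derive th 1 dn2 (- (q ^+ 2 * (2 * sin th * cos th))).
  rewrite /dn2; apply: is_derive_eq.
  by rewrite /GRing.scale/=; ring.
have d2 := is_derive1_sqrt (dn2_gt0 th).
have := is_derive1_comp d2 d1; rewrite /comp => d3.
apply: is_derive_eq d3 _; rewrite -/(dn th).
by field; rewrite gt_eqF// dn_gt0.
Qed.

Lemma continuous_dn : continuous dn.
Proof. exact: is_derive_continuous is_derive_dn. Qed.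

Lemma continuous_dnV : continuous (fun th => (dn th)^-1).
Proof. by move=> th; apply: cvgV; [rewrite gt_eqF// dn_gt0|exact: continuous_dn]. Qed.

Lemma is_derive_ellE (x : R) : is_derive x 1 (fun y => ellE y q) (dn x).
Proof. exact: is_derive_oint continuous_dn. Qed.

Lemma is_derive_ellF (x : R) : is_derive x 1 (fun y => ellF y q) (dn x)^-1.
Proof. exact: (is_derive_oint _ continuous_dnV). Qed.

Lemma ellF0 : ellF 0 q = 0.
Proof. by rewrite /ellF /oint lexx set_itv1 Rintegral_set1. Qed.

Lemma dn_opp (th : R) : dn (- th) = dn th.
Proof. by rewrite /dn /dn2 sinN sqrrN. Qed.

Lemma dn_pi (th : R) : dn (th + pi) = dn th.
Proof. by rewrite /dn /dn2 sinDpi sqrrN. Qed.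

Lemma ellF_odd (x : R) : ellF (- x) q = - ellF x q.
Proof.
apply/eqP; rewrite -addr_eq0; apply/eqP.
have d0 (y : R) : is_derive y 1 (fun y => ellF (- y) q + ellF y q) 0.
  apply: is_derive_eq.
    exact: is_deriveD (is_derive1_reflect (is_derive_ellF _)) (is_derive_ellF _).
  by rewrite dn_opp addNr.
by rewrite (is_derive_0_is_cst x 0 d0) oppr0 ellF0 addr0.
Qed.

Lemma ellF_pi (x : R) : ellF (x + pi) q = ellF x q + 2 * ellK q.
Proof.
have d0 (y : R) : is_derive y 1 (fun y => ellF (y + pi) q - ellF y q) 0.
  apply: is_derive_eq.
    exact: is_deriveB (is_derive1_shift (is_derive_ellF _)) (is_derive_ellF _).
  by rewrite dn_pi subrr.
(* The constant is read off at [- pi / 2], where oddness turns the difference into [2 * ellK q]. *)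
have := is_derive_0_is_cst x (- (pi / 2)) d0.
rewrite ellF_odd (_ : - (pi / 2) + pi = pi / 2 :> R); last by lra.
by rewrite /ellK; lra.
Qed.

(** The integrand [1 / dn] is at least [1]. Expansion yields injectivity of [ellF] and also the
    growth that makes its inverse [am] defined everywhere. *)
Lemma ellF_expand (x y : R) : x < y -> y - x <= ellF y q - ellF x q.
Proof.
move=> xy.
have [|c _ ->] := @MVT _ (fun t => ellF t q) (fun t => (dn t)^-1) x y xy (fun t _ => is_derive_ellF t).
  by apply: continuous_subspaceT; exact: is_derive_continuous is_derive_ellF.
by rewrite ler_peMl ?subr_ge0 ?(ltW xy)// invf_ge1 ?dn_gt0// dn_le1.
Qed.

Lemma ellF_inj : injective (fun x => ellF x q).
Proof.
move=> x y /= Fxy; have [xy|yx|//] := ltgtP x y.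
  by have := ellF_expand xy; rewrite Fxy subrr; lra.
by have := ellF_expand yx; rewrite Fxy subrr; lra.
Qed.

Lemma ellF_am (u : R) : ellF (am u q) q = u.
Proof.
rewrite /am; apply: (@xgetPex _ 0 [set y | ellF y q = u]).
have bnd (v : R) : 0 <= v -> v <= ellF v q.
  rewrite le_eqVlt => /predU1P[<-|v0]; first by rewrite ellF0.
  by have := ellF_expand v0; rewrite ellF0 !subr0.
(* By expansion and oddness, the values of [ellF] at the two ends of [[-|u|, |u|]] enclose [u]. *)
have uu : - `|u| <= `|u| by rewrite (@le_trans _ _ 0)// oppr_le0.
have [||c _ cE] := @IVT _ (fun t => ellF t q) _ _ u uu; last by exists c.
  by apply: continuous_subspaceT; exact: is_derive_continuous is_derive_ellF.
have h := bnd _ (normr_ge0 u).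
rewrite ge_min le_max ellF_odd; apply/andP; split; apply/orP; [left|right].
  by rewrite lerNl (le_trans _ h)// -normrN ler_norm.
by rewrite (le_trans _ h)// ler_norm.
Qed.

Lemma am_ellF (x : R) : am (ellF x q) q = x.
Proof. by apply: ellF_inj; rewrite /= ellF_am. Qed.

Lemma is_derive_am (u : R) : is_derive u 1 (fun v => am v q) (dn (am u q)).
Proof.
rewrite -{1}[u]ellF_am -[dn _]invrK.
apply: (@is_derive_inverse _ (fun y => ellF y q)).
- by near=> x; exact: am_ellF.
- by near=> x; exact: (is_derive_continuous is_derive_ellF).
- exact: is_derive_ellF.
- by rewrite invr_neq0// gt_eqF// dn_gt0.
Unshelve. all: by end_near. Qed.

Lemma am_odd (u : R) : am (- u) q = - am u q.
Proof. by apply: ellF_inj; rewrite /= ellF_odd !ellF_am. Qed.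

Lemma am_2K (u : R) : am (u + 2 * ellK q) q = am u q + pi.
Proof. by apply: ellF_inj; rewrite /= ellF_pi !ellF_am. Qed.

Lemma amK : am (ellK q) q = pi / 2.
Proof. exact: am_ellF. Qed.

Lemma ellK_gt0 : 0 < ellK q.
Proof.
have pi20 : 0 < pi / 2 :> R by rewrite divr_gt0 ?pi_gt0.
by have := ellF_expand pi20; rewrite ellF0 !subr0; exact: lt_le_trans.
Qed.

End EllipticFunctions.

(** * Complete elliptic integrals and the moduli [qstar], [qhat], [q1], [q2], [q3] *)

Section CompleteIntegrals.
Context {R : realType}.
Local Notation mu := (@lebesgue_measure R).
Implicit Types q r c : R.
Local Notation I := (`[0%R, (pi / 2)%R]%classic : set R).
Local Notation rt := ((Num.sqrt 2)^-1 : R).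

Lemma pi2_ge0 : 0 <= pi / 2 :> R. Proof. by rewrite divr_ge0 ?pi_ge0. Qed.

Lemma ellKE q : ellK q = \int[mu]_(th in I) (dn q th)^-1.
Proof. by rewrite /ellK /ellF /oint pi2_ge0. Qed.

Lemma ellEcE q : ellEc q = \int[mu]_(th in I) dn q th.
Proof. by rewrite /ellEc /ellE /oint pi2_ge0. Qed.

Lemma integral_primitive (F f : R -> R) (a b : R) : a <= b -> continuous f ->
  (forall x : R, a < x < b -> is_derive x 1 F (f x)) -> {within `[a, b], continuous F} ->
  \int[mu]_(x in `[a, b]) f x = F b - F a.
Proof.
rewrite le_eqVlt => /predU1P[<- _ _|ab cf dF cF].
  by rewrite subrr set_itv1 Rintegral_set1.
have [_ cl cr] := (continuous_within_itvP _ ab).1 cF.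
rewrite /Rintegral (@continuous_FTC2 _ f F)//.
- exact: continuous_subspaceT.
- by split=> // x; rewrite in_itv/= => axb; apply: ex_derive; exact: dF.
- by move=> x; rewrite in_itv/= => axb; rewrite derive1E; apply: derive_val; exact: dF.
Qed.

Lemma integral_itv_cst (a b c : R) : a <= b -> \int[mu]_(x in `[a, b]) c = c * (b - a).
Proof.
move=> ab; rewrite mulrBr; apply: (@integral_primitive (fun x => c * x) (fun=> c)) => //.
- by move=> x; exact: cvg_cst.
- move=> x _; apply: is_derive_eq; rewrite /GRing.scale/=; ring.
- by apply: continuous_subspaceT => x; apply: cvgM; [exact: cvg_cst|exact: cvg_id].
Qed.

Lemma le_integral_itv (f g : R -> R) (a b : R) : continuous f -> continuous g ->
  (forall x : R, a <= x <= b -> f x <= g x) ->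
  \int[mu]_(x in `[a, b]) f x <= \int[mu]_(x in `[a, b]) g x.
Proof.
move=> cf cg fg; apply: le_Rintegral; [by []|exact: (continuous_integrable _ _ cf)|exact: (continuous_integrable _ _ cg)|].
by move=> x; rewrite /= in_itv/=; exact: fg.
Qed.

Lemma continuous_dn_q (th : R) : continuous (fun q => dn q th).
Proof.
move=> q; apply: (@cvg_comp _ _ _ (fun q => dn2 q th) Num.sqrt); last exact: sqrt_continuous.
rewrite /dn2; apply: cvgB; first exact: cvg_cst.
by apply: cvgM; [exact: exprn_continuous|exact: cvg_cst].
Qed.

Lemma dn_anti (q r th : R) : 0 <= q -> q <= r -> r < 1 -> dn r th <= dn q th.
Proof.
move=> q0 qr r1; rewrite ler_sqrt; last by rewrite ltW// dn2_gt0// q0 (le_lt_trans qr).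
by rewrite lerD2l lerN2 ler_wpM2r ?sqr_ge0// ler_pXn2r// nnegrE (le_trans q0).
Qed.

Lemma dn_abs q (th : R) : dn `|q| th = dn q th.
Proof. by rewrite /dn /dn2 real_normK ?num_real. Qed.

Lemma q_lt_mid q : 0 <= q < 1 -> exists2 r : R, q < r & 0 <= r < 1.
Proof. by move=> /andP[q0 q1]; exists ((q + 1) / 2); lra. Qed.

(** Dominated convergence on []-r, r[] with [q < r < 1]. The symmetric interval is a neighbourhood
    of [q] even when [q = 0]; negative moduli reduce to [|q|] because [dn] depends on [q^2]. The
    dominating constant is the largest value of [1 / dn r], taken at [pi / 2]. *)
Lemma continuous_ellK q : 0 <= q < 1 -> {for q, continuous (@ellK R)}.
Proof.
move=> q01; have [r qr r01] := q_lt_mid q01; have /andP[q0 q1] := q01.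
have /andP[r0 r1] := r01.
rewrite (_ : @ellK R = fun q => \int[mu]_(th in I) (dn q th)^-1); last first.
  by apply/funext => ?; rewrite ellKE.
have sub (x : R) : x \in `](- r), r[%R -> 0 <= `|x| < 1.
  by rewrite in_itv/= => /andP[rx xr]; rewrite normr_ge0/= ltr_norml; lra.
apply: (@continuity_under_integral _ _ _ mu (fun q th => (dn q th)^-1) I _ (- r) r _ _
   (fun=> (dn r (pi / 2))^-1)) => //.
- move=> x /sub x01; apply: continuous_integrable => th.
  under eq_fun do rewrite -dn_abs.
  exact: continuous_dnV.
- apply: aeW => th _ x /set_mem/sub x01; apply: cvgV; last exact: continuous_dn_q.
  by rewrite -dn_abs gt_eqF// dn_gt0.
- by apply: continuous_integrable => th; exact: cvg_cst.
- move=> x xr; apply: aeW => th _; have x01 := sub _ xr.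
  rewrite -dn_abs gtr0_norm ?invr_gt0 ?dn_gt0// lef_pV2 ?posrE ?dn_gt0//.
  rewrite (le_trans _ (@dn_anti `|x| r th _ _ _))//; last first.
    by move: xr; rewrite /= in_itv/= => /andP[? ?]; rewrite ler_norml !ltW.
  rewrite ler_sqrt; last by rewrite ltW// dn2_gt0.
  rewrite /dn2 sin_pihalf expr1n mulr1.
  exact: dn2_ge.
- by rewrite inE/= in_itv/= qr andbT; lra.
Qed.

Lemma continuous_ellEc q : 0 <= q < 1 -> {for q, continuous (@ellEc R)}.
Proof.
move=> q01; have [r qr r01] := q_lt_mid q01; have /andP[q0 q1] := q01.
have /andP[r0 r1] := r01.
rewrite (_ : @ellEc R = fun q => \int[mu]_(th in I) dn q th); last first.
  by apply/funext => ?; rewrite ellEcE.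
have sub (x : R) : x \in `](- r), r[%R -> 0 <= `|x| < 1.
  by rewrite in_itv/= => /andP[rx xr]; rewrite normr_ge0/= ltr_norml; lra.
apply: (@continuity_under_integral _ _ _ mu dn I _ (- r) r _ _ (fun=> 1)) => //.
- move=> x /sub x01; apply: continuous_integrable.
  have -> : dn x = dn `|x| by apply/funext => th; rewrite dn_abs.
  exact: continuous_dn.
- by apply: aeW => th _ x /set_mem/sub x01; exact: continuous_dn_q.
- by apply: continuous_integrable => th; exact: cvg_cst.
- move=> x xr; apply: aeW => th _; have x01 := sub _ xr.
  by rewrite -dn_abs gtr0_norm ?dn_gt0// dn_le1.
- by rewrite inE/= in_itv/= qr andbT; lra.
Qed.

Lemma ellEc_gt0 q : 0 <= q < 1 -> 0 < ellEc q.
Proof.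
move=> q01; rewrite ellEcE.
apply: (@lt_le_trans _ _ (\int[mu]_(th in I) dn q (pi / 2))).
  by rewrite integral_itv_cst ?pi2_ge0// mulr_gt0 ?dn_gt0// subr0 divr_gt0 ?pi_gt0.
apply: le_integral_itv => [th|th|th _]; [exact: cvg_cst|exact: continuous_dn|].
rewrite ler_sqrt; last by rewrite ltW// dn2_gt0.
by rewrite /dn2 sin_pihalf expr1n mulr1; exact: dn2_ge.
Qed.

Lemma ellEc_le q : 0 <= q < 1 -> ellEc q <= pi / 2.
Proof.
move=> q01; rewrite ellEcE.
apply: (@le_trans _ _ (\int[mu]_(th in I) 1)).
  apply: le_integral_itv => [th|th|th _]; [exact: continuous_dn|exact: cvg_cst|].
  exact: dn_le1.
by rewrite integral_itv_cst ?pi2_ge0// mul1r subr0.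
Qed.

(** Times [2 / al], this is the signed horizontal span of a single arc in the arc formula; its sign
    separates arcs from loops. *)
Definition twoEK q : R := 2 * ellEc q - ellK q.

Lemma twoEKE q : 0 <= q < 1 -> twoEK q = \int[mu]_(th in I) (2 * dn q th - (dn q th)^-1).
Proof.
move=> q01; rewrite /twoEK ellEcE ellKE.
have c1 := continuous_dn q01; have c2 := continuous_dnV q01.
have c3 : continuous (fun th => 2 * dn q th).
  by move=> th; apply: cvgM; [exact: cvg_cst|exact: c1].
rewrite RintegralB//; [|exact: continuous_integrable..].
by rewrite RintegralZl//; exact: continuous_integrable.
Qed.

Lemma continuous_twoEK q : 0 <= q < 1 -> {for q, continuous twoEK}.
Proof.
move=> q01; apply: cvgB; last exact: continuous_ellK.
by apply: cvgM; [exact: cvg_cst|exact: continuous_ellEc].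
Qed.

Lemma continuous_integrand q : 0 <= q < 1 ->
  continuous (fun th => 2 * dn q th - (dn q th)^-1).
Proof.
move=> q01 th; apply: cvgB; last exact: continuous_dnV.
by apply: cvgM; [exact: cvg_cst|exact: continuous_dn].
Qed.

Lemma twoEK_anti q r : 0 <= q -> q <= r -> r < 1 -> twoEK r <= twoEK q.
Proof.
move=> q0 qr r1.
have r01 : 0 <= r < 1 by rewrite r1 (le_trans q0).
have q01 : 0 <= q < 1 by rewrite q0 (le_lt_trans qr).
rewrite !twoEKE//; apply: le_integral_itv => [||th _]; [exact: continuous_integrand..|].
have d := dn_anti th q0 qr r1.
rewrite lerB ?ler_wpM2l// lef_pV2 ?posrE ?dn_gt0//.
Qed.

Lemma sin_le (x : R) : 0 <= x -> sin x <= x.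
Proof.
rewrite le_eqVlt => /predU1P[<-|x0]; first by rewrite sin0.
have [|c _] := @MVT _ sin cos 0 x x0 (fun t _ => is_derive_sin t).
  by apply: continuous_subspaceT; exact: continuous_sin.
rewrite sin0 !subr0 => ->; rewrite ger_pMl//; exact: cos_le1.
Qed.

(* Near [th = pi / 2] the integrand of [K] is at least [1 / (pi / 2 - th + e)],
   with [e ^ 2 = 1 - q ^ 2]. *)
Lemma ellK_ge_ln q (e : R) : 0 <= q < 1 -> 0 < e -> q ^+ 2 + e ^+ 2 = 1 ->
  ln (pi / 2 + e) - ln e <= ellK q.
Proof.
move=> q01 e0 qe; rewrite ellKE.
(* The absolute value makes [1 / w] continuous on the whole line; on the range of integration [w] is
   [pi / 2 - th + e]. *)
pose w (th : R) : R := `|pi / 2 - th| + e.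
have wE (th : R) : 0 <= th <= pi / 2 -> w th = pi / 2 - th + e.
  by move=> /andP[_ h]; rewrite /w ger0_norm// subr_ge0.
have w0 (th : R) : 0 < w th.
  by rewrite /w ltr_wpDl.
have cw : continuous (fun th => (w th)^-1).
  move=> th; apply: cvgV; first by rewrite gt_eqF.
  apply: cvgD; last exact: cvg_cst.
  by apply: cvg_norm; apply: cvgB; [exact: cvg_cst|exact: cvg_id].
have dw (x : R) : 0 <= pi / 2 - x -> is_derive x 1 (fun t => - ln (pi / 2 - t + e)) (pi / 2 - x + e)^-1.
  move=> hx.
  have h0 : 0 < pi / 2 - x + e by rewrite ltr_wpDl.
  have d1 : is_derive x 1 (fun t => pi / 2 - t + e) (-1).
    by apply: is_derive_eq; rewrite /GRing.scale/=; ring.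
  have d2 := @is_derive1_comp _ (@ln R) (fun t => pi / 2 - t + e) x _ _ (is_derive1_ln h0) d1.
  by apply: is_derive_eq (is_deriveN d2) _; rewrite mulrN1 opprK.
have -> : ln (pi / 2 + e) - ln e = \int[mu]_(th in I) (w th)^-1.
  pose P (th : R) := - ln (pi / 2 - th + e).
  have -> : \int[mu]_(th in I) (w th)^-1 = P (pi / 2) - P 0; last first.
    by rewrite /P subrr add0r subr0; lra.
  apply: integral_primitive; rewrite ?pi2_ge0//.
  - move=> x /andP[x0 x1]; rewrite wE ?(ltW x0) ?ltW//.
    by apply: dw; rewrite subr_ge0 ltW.
  - apply: derivable_within_continuous => x; rewrite in_itv/= => /andP[_ x1].
    by apply: ex_derive; apply: dw; rewrite subr_ge0.
apply: le_integral_itv => //; first exact: continuous_dnV.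
move=> th th01; have /andP[t0 t1] := th01.
rewrite lef_pV2 ?posrE ?dn_gt0//.
rewrite -[leRHS]ger0_norm ?(ltW (w0 th))// -sqrtr_sqr ler_sqrt ?sqr_ge0//.
rewrite (wE _ th01) /dn2.
(* Here [dn^2 = cos^2 + e^2 * sin^2] is at most [(pi / 2 - th)^2 + e^2], hence at most [w^2]. *)
have c1 : cos th <= pi / 2 - th.
  by rewrite -[th](subKr (pi / 2)) cosB cos_pihalf sin_pihalf mul0r add0r mul1r
     subKr sin_le// subr_ge0.
have c0 : 0 <= cos th.
  by apply: cos_ge0_pihalf; rewrite t1 andbT (le_trans _ t0)// oppr_le0 pi2_ge0.
have := cos2Dsin2 th; have := sqr_ge0 (sin th); have := sqr_ge0 (cos th).
have -> : q ^+ 2 = 1 - e ^+ 2 by lra.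
nra.
Qed.

Lemma ellK_unbounded (b B : R) : b < 1 -> exists2 q : R, b < q & 0 <= q < 1 /\ B <= ellK q.
Proof.
move=> b1.
(* The bound [1 / 2] keeps [1 - e0^2] positive, [(1 - b) / 2] pushes [q] beyond [b], and
   [expR (- B)] gives [- ln e0 >= B]. *)
pose e0 : R := Num.min (1 / 2) (Num.min ((1 - b) / 2) (expR (- B))).
have e0p : 0 < e0.
  by rewrite !lt_min expR_gt0 andbT; apply/andP; split; lra.
have [h1 h2 h3] : [/\ e0 <= 1 / 2, e0 <= (1 - b) / 2 & e0 <= expR (- B)].
  by split; rewrite /e0 !ge_min lexx ?orbT.
pose q := Num.sqrt (1 - e0 ^+ 2).
have p0 : 0 <= 1 - e0 ^+ 2 by nra.
have q2 : q ^+ 2 = 1 - e0 ^+ 2 by rewrite sqr_sqrtr.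
have q0 : 0 <= q by exact: sqrtr_ge0.
have q1 : q < 1 by nra.
exists q; first by nra.
split; first by rewrite q0.
have qe : q ^+ 2 + e0 ^+ 2 = 1 by rewrite q2 subrK.
have q01 : 0 <= q < 1 by rewrite q0.
apply: le_trans (ellK_ge_ln q01 e0p qe).
have l1 : 0 <= ln (pi / 2 + e0).
  by rewrite ln_ge0// ler_wpDr ?(ltW e0p)// pihalf_ge1.
have l2 : ln e0 <= - B.
  by rewrite -[leRHS]expRK ler_ln ?posrE ?expR_gt0.
lra.
Qed.

Lemma rt_sqr : rt ^+ 2 = 1 / 2.
Proof. by rewrite exprVn sqr_sqrtr// div1r. Qed.

Lemma rt_bounds : 0 < rt < 1.
Proof.
have r0 : 0 < rt by rewrite invr_gt0 sqrtr_gt0.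
have := rt_sqr; rewrite r0/=; nra.
Qed.

Lemma rt_lt q : rt < q -> 1 / 2 < q ^+ 2.
Proof. by move=> h; rewrite -rt_sqr; have /andP[] := rt_bounds; nra. Qed.

(** At [q^2 = 1 / 2] one has [2 * dn^2 - 1 = cos^2], so the integrand [2 * dn - 1 / dn] equals
    [cos^2 / dn] and dominates [cos^2]. *)
Lemma twoEK_rt : 0 < twoEK rt.
Proof.
have /andP[r0 r1] := rt_bounds.
have r01 : 0 <= rt < 1 by rewrite ltW.
rewrite twoEKE//.
have c2 : continuous (fun th : R => cos th ^+ 2).
  move=> th; apply: (@cvg_comp _ _ _ cos (fun x => x ^+ 2)); first exact: continuous_cos.
  exact: exprn_continuous.
apply: (@lt_le_trans _ _ (\int[mu]_(th in I) (cos th ^+ 2))).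
  pose F (th : R) := (th + sin th * cos th) / 2.
  have dF (x : R) : is_derive x 1 F (cos x ^+ 2).
    rewrite /F; apply: is_derive_eq.
    rewrite !scaler0 add0r /GRing.scale/=; have := cos2Dsin2 x; lra.
  rewrite (integral_primitive pi2_ge0 c2 (fun x _ => dF x)).
    by rewrite /F cos_pihalf sin0 mulr0 mul0r !addr0 mul0r subr0 !divr_gt0 ?pi_gt0.
  by apply: continuous_subspaceT; exact: (is_derive_continuous dF).
apply: le_integral_itv => // [|th _]; first exact: continuous_integrand.
have d0 := dn_gt0 r01 th; have d1 := dn_le1 rt th; have := sqr_dn r01 th.
rewrite /dn2 rt_sqr sin2cos2 => d2.
have -> : cos th ^+ 2 = 2 * dn rt th ^+ 2 - 1 by lra.
rewrite -(ler_pM2r d0) [leRHS]mulrBl mulVf ?gt_eqF//.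
nra.
Qed.

Lemma ivt_le (f : R -> R) (a b v : R) : a <= b ->
  (forall x : R, a <= x <= b -> {for x, continuous f}) ->
  (f a <= v <= f b) \/ (f b <= v <= f a) -> exists2 c : R, a <= c <= b & f c = v.
Proof.
move=> ab cf h.
have [||c cab fc] := @IVT _ f a b v ab; last by exists c.
- by apply: continuous_in_subspaceT => x /set_mem/=; rewrite in_itv/=; exact: cf.
- by rewrite ge_min le_max; case: h => /andP[-> ->]; rewrite ?orbT.
Qed.

(** An [xget] constant satisfies its defining property once the set is inhabited. A sign change of
    [twoEK] inhabits it: [2 * ellEc] is at most [pi], and some [q > rt] has [ellK q >= 2 * pi].
    Monotonicity and [twoEK_rt] then place the zero beyond [rt]. *)
Lemma qstar_spec : [/\ rt < qstar R, qstar R < 1 & twoEK (qstar R) = 0].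
Proof.
have /andP[r0 r1] := rt_bounds.
suff : 0 < qstar R < 1 /\ twoEK (qstar R) = 0.
  move=> [/andP[s0 s1] s2]; split=> //; rewrite ltNge; apply/negP => h.
  have := twoEK_anti (ltW s0) h r1.
  by rewrite s2 leNgt twoEK_rt.
apply: (@xgetPex _ 0 [set q | 0 < q < 1 /\ 2 * ellEc q - ellK q = 0]).
have [q rq [q01 Kq]] := @ellK_unbounded rt (2 * pi) r1.
have hq : twoEK q <= 0.
  by rewrite /twoEK; have := ellEc_le q01; have := pi_gt0 R; lra.
have /andP[q0 q1] := q01.
have [||c /andP[c1 c2] tc] := @ivt_le twoEK rt q 0 (ltW rq).
- by move=> x /andP[x0 x1]; apply: continuous_twoEK; lra.
- by right; rewrite hq ltW// twoEK_rt.
by exists c; split=> //; lra.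
Qed.

(** This grouping shows the signs: for [1 / 2 < q^2 < 1] the coefficient of [twoEK] is positive and
    that of [ellEc] is negative, so [fq] is negative wherever [twoEK] is nonpositive. *)
Lemma fqE q : fq q = (4 * q ^+ 2 - 1) * (1 - q ^+ 2) * twoEK q + (1 - 2 * q ^+ 2) * ellEc q.
Proof. by rewrite /fq /twoEK; ring. Qed.

Lemma gqE q : gq q = 8 * twoEK q ^+ 2 * (2 * q ^+ 2 - 1).
Proof. by []. Qed.

Lemma continuous_X (n : nat) q : {for q, continuous (fun x : R => x ^+ n)}.
Proof. exact: exprn_continuous. Qed.

Lemma continuous_fq q : 0 <= q < 1 -> {for q, continuous (@fq R)}.
Proof.
move=> q01; have -> : @fq R = fun q => (4 * q ^+ 2 - 1) * (1 - q ^+ 2) * twoEK q + (1 - 2 * q ^+ 2) * ellEc q.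
  by apply/funext => x; rewrite fqE.
have c (a : R) : cst a x @[x --> q] --> a by exact: cvg_cst.
have x2 : x ^+ 2 @[x --> q] --> q ^+ 2 by exact: continuous_X.
apply: cvgD.
  apply: (cvgM (cvgM (cvgB (cvgM (c 4) x2) (c 1)) (cvgB (c 1) x2))).
  exact: continuous_twoEK.
by apply: (cvgM (cvgB (c 1) (cvgM (c 2) x2))); exact: continuous_ellEc.
Qed.

Lemma continuous_gq q : 0 <= q < 1 -> {for q, continuous (@gq R)}.
Proof.
move=> q01.
have c (a : R) : cst a x @[x --> q] --> a by exact: cvg_cst.
have x2 : x ^+ 2 @[x --> q] --> q ^+ 2 by exact: continuous_X.
have -> : @gq R = fun q => 8 * twoEK q ^+ 2 * (2 * q ^+ 2 - 1) by [].
suff t2 : twoEK x ^+ 2 @[x --> q] --> twoEK q ^+ 2.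
  exact: (cvgM (cvgM (c 8) t2) (cvgB (cvgM (c 2) x2) (c 1))).
apply: (@cvg_comp _ _ _ twoEK (fun x => x ^+ 2)); first exact: continuous_twoEK.
exact: exprn_continuous.
Qed.

(** [fq] is positive at [rt] and negative at [qstar], which produces a zero. At a zero the sign
    pattern of [fqE] forces [twoEK > 0]; this puts [qhat] before [qstar] and makes [lamhat]
    positive. *)
Lemma qhat_spec : [/\ rt < qhat R, qhat R < qstar R & 0 < lamhat R].
Proof.
have /andP[r0 r1] := rt_bounds.
have [s0 s1 s2] := qstar_spec.
have frt : 0 < fq rt.
  by rewrite fqE rt_sqr; have := twoEK_rt; set t := twoEK rt => t0; lra.
have fneg q : rt < q -> q < 1 -> twoEK q <= 0 -> fq q < 0.
  move=> rq q1 tq; rewrite fqE; have q2 := rt_lt rq.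
  have q01 : 0 <= q < 1 by rewrite q1 (le_trans (ltW r0) (ltW rq)).
  have q3 := sqr_q_lt1 q01; have E0 := ellEc_gt0 q01.
  have h1 : 0 < (4 * q ^+ 2 - 1) * (1 - q ^+ 2) by apply: mulr_gt0; lra.
  have h2 : (4 * q ^+ 2 - 1) * (1 - q ^+ 2) * twoEK q <= 0 by rewrite pmulr_rle0.
  have h3 : (1 - 2 * q ^+ 2) * ellEc q < 0 by rewrite pmulr_llt0//; lra.
  lra.
have [/andP[h0 h1] h2] : rt <= qhat R < 1 /\ fq (qhat R) = 0.
  apply: (@xgetPex _ 0 [set q | (Num.sqrt 2)^-1 <= q < 1 /\ fq q = 0]).
  have [||c /andP[c1 c2] fc] := @ivt_le (@fq R) rt (qstar R) 0 (ltW s0).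
  - by move=> x /andP[x0 x1]; apply: continuous_fq; lra.
  - by right; rewrite !ltW//; apply: fneg => //; rewrite s2.
  by exists c; split=> //; rewrite c1/=; lra.
have rh : rt < qhat R.
  rewrite lt_neqAle h0 andbT; apply/eqP => E; move: h2; rewrite -E => E2.
  by move: frt; rewrite E2 ltxx.
have tpos : 0 < twoEK (qhat R).
  rewrite ltNge; apply/negP => h; have := fneg _ rh h1 h.
  by rewrite h2 ltxx.
split=> //.
  rewrite ltNge; apply/negP => h; have := twoEK_anti _ h h1.
  by rewrite s2 => /(_ ltac:(lra)); rewrite leNgt tpos.
rewrite /lamhat gqE; have := rt_lt rh => q2.
by apply: mulr_gt0; [apply: mulr_gt0 => //; exact: exprn_gt0|lra].
Qed.

Lemma gq_neq0 q : gq q != 0 -> twoEK q != 0.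
Proof. by rewrite gqE; apply: contra_neq => ->; rewrite expr0n/= mulr0 mul0r. Qed.

(** Intermediate values of [gq], which goes from [0] at [rt] to [lamhat] at [qhat]. Positivity of
    [c] excludes the end [rt] and makes [twoEK] nonzero, which sharpens the sign obtained from
    [twoEK_anti]. *)
Lemma q1_spec c : 0 < c -> c <= lamhat R ->
  [/\ 1 / 2 < q1 c ^+ 2, 0 <= q1 c < 1, gq (q1 c) = c & 0 < twoEK (q1 c)].
Proof.
move=> c0 cl; have /andP[r0 r1] := rt_bounds.
have [s0 s1 s2] := qstar_spec; have [h0 h1 h2] := qhat_spec.
have [/andP[a1 a2] a3] : rt < q1 c <= qhat R /\ gq (q1 c) = c.
  apply: (@xgetPex _ 0 [set q | (Num.sqrt 2)^-1 < q <= qhat R /\ gq q = c]).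
  have grt : gq rt = 0 by rewrite gqE rt_sqr; lra.
  have [||x /andP[x1 x2] gx] := @ivt_le (@gq R) rt (qhat R) c (ltW h0).
  - by move=> x /andP[x0 x1]; apply: continuous_gq; lra.
  - by left; rewrite grt (ltW c0).
  exists x; split=> //; rewrite x2 andbT lt_neqAle x1 andbT.
  by apply/eqP => E; move: c0; rewrite -gx -E grt ltxx.
split=> //; [exact: rt_lt|lra|].
rewrite lt_neqAle eq_sym gq_neq0 ?a3 ?gt_eqF//=.
by rewrite -s2 twoEK_anti//; lra.
Qed.

Lemma q2_spec c : 0 < c -> c <= lamhat R ->
  [/\ 1 / 2 < q2 c ^+ 2, 0 <= q2 c < 1, gq (q2 c) = c & 0 < twoEK (q2 c)].
Proof.
move=> c0 cl; have /andP[r0 r1] := rt_bounds.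
have [s0 s1 s2] := qstar_spec; have [h0 h1 h2] := qhat_spec.
have [/andP[a1 a2] a3] : qhat R <= q2 c < qstar R /\ gq (q2 c) = c.
  apply: (@xgetPex _ 0 [set q | qhat R <= q < qstar R /\ gq q = c]).
  have gst : gq (qstar R) = 0 by rewrite gqE s2 expr0n/= mulr0 mul0r.
  have [||x /andP[x1 x2] gx] := @ivt_le (@gq R) (qhat R) (qstar R) c (ltW h1).
  - by move=> x /andP[x0 x1]; apply: continuous_gq; lra.
  - by right; rewrite gst (ltW c0).
  exists x; split=> //; rewrite x1/= lt_neqAle x2 andbT.
  by apply/eqP => E; move: c0; rewrite -gx E gst ltxx.
split=> //; [by apply: rt_lt; lra|lra|].
rewrite lt_neqAle eq_sym gq_neq0 ?a3 ?gt_eqF//=.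
by rewrite -s2 twoEK_anti//; lra.
Qed.

Lemma q3_spec c : 0 < c ->
  [/\ 1 / 2 < q3 c ^+ 2, 0 <= q3 c < 1, gq (q3 c) = c & twoEK (q3 c) < 0].
Proof.
move=> c0; have /andP[r0 r1] := rt_bounds.
have [s0 s1 s2] := qstar_spec.
have [/andP[a1 a2] a3] : qstar R < q3 c < 1 /\ gq (q3 c) = c.
  apply: (@xgetPex _ 0 [set q | qstar R < q < 1 /\ gq q = c]).
  have gst : gq (qstar R) = 0 by rewrite gqE s2 expr0n/= mulr0 mul0r.
  (* Beyond [9 / 10] the factor [2 * q^2 - 1] exceeds [1 / 2], and [ellK q >= pi + 1 + c] gives
     [twoEK q <= - (1 + c)]; together they yield [gq q >= c]. *)
  have [q sq [q01 Kq]] := @ellK_unbounded (Num.max (qstar R) (9 / 10)) (pi + 1 + c) ltac:(by rewrite gt_max s1; lra).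
  move: sq; rewrite gt_max => /andP[sq q9]; have /andP[q0 q1] := q01.
  have tq : twoEK q <= - (1 + c) by rewrite /twoEK; have := ellEc_le q01; lra.
  have [||x /andP[x1 x2] gx] := @ivt_le (@gq R) (qstar R) q c (ltW sq).
  - by move=> x /andP[x0 x1]; apply: continuous_gq; lra.
  - left; rewrite gst (ltW c0)/= gqE.
    have t2 : c <= twoEK q ^+ 2 by rewrite expr2; nra.
    have h2 : 1 / 2 <= 2 * q ^+ 2 - 1 by nra.
    have := sqr_ge0 (twoEK q); nra.
  exists x; split=> //; rewrite (le_lt_trans x2 q1) andbT lt_neqAle x1 andbT.
  by apply/eqP => E; move: c0; rewrite -gx -E gst ltxx.
split=> //; [by apply: rt_lt; lra|lra|].
rewrite lt_neqAle gq_neq0 ?a3 ?gt_eqF//=.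
by rewrite -s2 twoEK_anti//; lra.
Qed.

Lemma le_lamhat (lam l : R) (n : nat) : (0 < n)%N ->
  (nlam lam l <= n%:Z)%R -> lam * l ^+ 2 / n%:R ^+ 2 <= lamhat R.
Proof.
move=> n0; have [_ _ L0] := qhat_spec; rewrite /nlam => h.
have {h} : Num.sqrt (lam * l ^+ 2 / lamhat R) <= n%:R.
  by move: h; rewrite real_ceil_le_int// num_real.
set x := lam * l ^+ 2 => h.
have n2 : 0 < n%:R ^+ 2 :> R by rewrite exprn_gt0// ltr0n.
rewrite ler_pdivrMr// mulrC -ler_pdivrMr//.
have [x0|x0] := leP 0 (x / lamhat R); last by rewrite ltW// (lt_le_trans x0)// ltW.
by rewrite -(sqr_sqrtr x0) ler_pXn2r// nnegrE ?sqrtr_ge0 ?ler0n.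
Qed.

End CompleteIntegrals.

(** * The geometric properties of an elastica shared by arcs and loops *)

Section Profile.
Context {R : realType}.
Implicit Types (X Y : R -> R).

(** An arclength parametrized elastica [(X, Y)] whose signed curvature is [- k * Y];
    [k] is [alpha ^ 2] for arcs and [- alpha ^ 2] for loops, and [T] is the
    length of two consecutive arcs. *)
Record elastica_profile (k lam T : R) (X Y x1 y1 : R -> R) : Prop := ElasticaProfile {
  prof_dX : forall s : R, is_derive s 1 X (x1 s);
  prof_dY : forall s : R, is_derive s 1 Y (y1 s);
  prof_dx1 : forall s : R, is_derive s 1 x1 (k * Y s * y1 s);
  prof_dy1 : forall s : R, is_derive s 1 y1 (- (k * Y s * x1 s));
  prof_unit : forall s : R, x1 s ^+ 2 + y1 s ^+ 2 = 1;
  prof_curv : forall s : R, (k * Y s) ^+ 2 = 2 * k * x1 s + lam;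
  prof_x1N : forall s : R, x1 (- s) = x1 s;
  prof_y1N : forall s : R, y1 (- s) = y1 s;
  prof_YN : forall s : R, Y (- s) = - Y s;
  prof_x1T : forall s : R, x1 (s + T) = x1 s;
  prof_y1T : forall s : R, y1 (s + T) = y1 s;
  prof_YT : forall s : R, Y (s + T) = Y s;
  prof_XT : forall s : R, X (s + T) - X s = X T - X 0;
  prof_T : 0 < T;
  prof_k : k != 0;
  prof_x1 : x1 0 != 0;
  prof_y1 : y1 0 != 0 }.

(** The sign [t] is [1] for arcs and [- 1] for loops. The shift by [ellK q] puts a curvature zero at
    [s = 0], where the amplitude is [- pi / 2]; there [x1] equals [t * (1 - 2 * q^2)], nonzero since
    [q^2 > 1 / 2]. *)
Lemma jacobi_profile (q al t lam : R) : 0 <= q < 1 -> 1 / 2 < q ^+ 2 -> 0 < al ->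
  t ^+ 2 = 1 -> al ^+ 2 * (4 * q ^+ 2 - 2) = lam ->
  let A s := am (al * s - ellK q) q in
  elastica_profile (t * al ^+ 2) lam (4 * ellK q / al)
    (fun s => al^-1 * (t * (2 * ellE (A s) q + 2 * ellEc q - al * s)))
    (fun s => al^-1 * (2 * q * cn (al * s - ellK q) q))
    (fun s => t * (1 - 2 * q ^+ 2 * sin (A s) ^+ 2))
    (fun s => - (2 * q * sin (A s) * dn q (A s))).
Proof.
move=> q01 q2 al0 t2 lamE A.
have aln0 : al != 0 by rewrite gt_eqF.
have q0 : 0 < q by move: q01 => /andP[q0 _]; rewrite lt_neqAle q0 andbT; apply/eqP => E; move: q2; rewrite -E expr0n/=; lra.
have dA (s : R) : is_derive s 1 A (al * dn q (A s)).
  have d1 : is_derive s 1 (fun s => al * s - ellK q) al.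
    by apply: is_derive_eq; rewrite /GRing.scale/=; ring.
  have := @is_derive1_comp _ (fun v => am v q) (fun s => al * s - ellK q) s _ _ (is_derive_am q01 _) d1.
  by rewrite mulrC.
have dS (s : R) : is_derive s 1 (fun s => sin (A s)) (cos (A s) * (al * dn q (A s))).
  exact: (@is_derive1_comp _ sin A s _ _ (is_derive_sin _) (dA s)).
have dC (s : R) : is_derive s 1 (fun s => cos (A s)) (- sin (A s) * (al * dn q (A s))).
  exact: (@is_derive1_comp _ cos A s _ _ (is_derive_cos _) (dA s)).
have dD (s : R) : is_derive s 1 (fun s => dn q (A s)) (- (q ^+ 2 * sin (A s) * cos (A s)) * al).
  apply: is_derive_eq (@is_derive1_comp _ (dn q) A s _ _ (is_derive_dn q01 _) (dA s)) _.
  by field; rewrite gt_eqF// dn_gt0.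
have dE (s : R) : is_derive s 1 (fun s => ellE (A s) q) (dn q (A s) * (al * dn q (A s))).
  exact: (@is_derive1_comp _ (fun v => ellE v q) A s _ _ (is_derive_ellE q01 _) (dA s)).
have d2 (s : R) : dn q (A s) ^+ 2 = 1 - q ^+ 2 * sin (A s) ^+ 2 by rewrite sqr_dn.
(* The reflection [s -> - s] acts on the amplitude as [A -> - A - pi], which preserves [sin] and
   [dn] and reverses [cos]: this is the evenness of the tangent and the oddness of the height. *)
have AN (s : R) : A (- s) = - A s - pi.
  rewrite /A (_ : al * - s - ellK q = - (al * s - ellK q + 2 * ellK q)); last by lra.
  by rewrite am_odd// am_2K// opprD.
have AT (s : R) : A (s + 4 * ellK q / al) = A s + pi + pi.
  rewrite /A (_ : al * (s + 4 * ellK q / al) - ellK q =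
    al * s - ellK q + 2 * ellK q + 2 * ellK q); last by field.
  by rewrite !am_2K.
have A0 : A 0 = - (pi / 2) by rewrite /A mulr0 add0r am_odd// amK.
have SN (s : R) : sin (A (- s)) = sin (A s).
  by rewrite AN -opprD sinN sinDpi opprK.
have CN (s : R) : cos (A (- s)) = - cos (A s) by rewrite AN -opprD cosN cosDpi.
have ST (s : R) : sin (A (s + 4 * ellK q / al)) = sin (A s).
  by rewrite AT !sinDpi opprK.
have CT (s : R) : cos (A (s + 4 * ellK q / al)) = cos (A s).
  by rewrite AT !cosDpi opprK.
have DN (s : R) : dn q (A (- s)) = dn q (A s) by rewrite /dn /dn2 SN.
have DT (s : R) : dn q (A (s + 4 * ellK q / al)) = dn q (A s) by rewrite /dn /dn2 ST.
have dX (s : R) : is_derive s 1 (fun s => al^-1 * (t * (2 * ellE (A s) q + 2 * ellEc q - al * s)))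
   (t * (1 - 2 * q ^+ 2 * sin (A s) ^+ 2)).
  apply: is_derive_eq; rewrite /GRing.scale/=.
  transitivity (t * (2 * dn q (A s) ^+ 2 - 1)); first by field.
  by rewrite d2; ring.
split=> //.
- move=> s; rewrite /cn; apply: is_derive_eq; rewrite /GRing.scale/= -/(A s).
  by field.
- move=> s; rewrite /cn; apply: is_derive_eq; rewrite /GRing.scale/= -/(A s).
  by field.
- move=> s; apply: is_derive_eq; rewrite /GRing.scale/= /cn -/(A s).
  transitivity (- (2 * q * al * cos (A s) * (dn q (A s) ^+ 2 - q ^+ 2 * sin (A s) ^+ 2))); first by ring.
  rewrite d2; transitivity (- ((t ^+ 2) * (2 * q * al * cos (A s) * (1 - 2 * q ^+ 2 * sin (A s) ^+ 2)))).
    by rewrite t2; ring.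
  by field.
- move=> s; rewrite sqrrN !exprMn d2 t2; ring.
- move=> s; rewrite /cn -/(A s) -lamE.
  rewrite (_ : 2 * (t * al ^+ 2) * (t * (1 - 2 * q ^+ 2 * sin (A s) ^+ 2)) =
     t ^+ 2 * (2 * al ^+ 2 * (1 - 2 * q ^+ 2 * sin (A s) ^+ 2))); last by ring.
  rewrite (_ : (t * al ^+ 2 * (al^-1 * (2 * q * cos (A s)))) ^+ 2 =
     t ^+ 2 * (4 * al ^+ 2 * q ^+ 2 * cos (A s) ^+ 2)); last by field.
  by rewrite t2 cos2sin2; ring.
- by move=> s; rewrite SN.
- by move=> s; rewrite SN DN.
- by move=> s; rewrite /cn -!/(A _) CN; ring.
- by move=> s; rewrite ST.
- by move=> s; rewrite ST DT.
- by move=> s; rewrite /cn -!/(A _) CT.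
- move=> s; pose X s := al^-1 * (t * (2 * ellE (A s) q + 2 * ellEc q - al * s)).
  have d0 (y : R) : is_derive y 1 (fun y => X (y + 4 * ellK q / al) - X y) 0.
    have dX' (z : R) : is_derive z 1 X (t * (1 - 2 * q ^+ 2 * sin (A z) ^+ 2)) := dX z.
    have d1 := @is_derive1_shift R X (4 * ellK q / al) y _ (dX' _).
    apply: is_derive_eq (is_deriveB d1 (dX' y)) _.
    by rewrite ST subrr.
  by have := is_derive_0_is_cst s 0 d0; rewrite /X add0r.
- by rewrite divr_gt0// mulr_gt0// ellK_gt0.
- by rewrite mulf_neq0 ?expf_neq0//; apply: contra_eq_neq t2 => ->; rewrite expr0n/= eq_sym oner_eq0.
- rewrite A0 sinN sin_pihalf mulf_neq0//.
    by apply: contra_eq_neq t2 => ->; rewrite expr0n/= eq_sym oner_eq0.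
  by rewrite sqrrN expr1n; apply/eqP; lra.
- rewrite A0 sinN sin_pihalf mulrN1 mulNr opprK gt_eqF//.
  by rewrite !mulr_gt0 ?dn_gt0.
Qed.

End Profile.

(** * Energy and norm of a plane curve in terms of weak derivatives *)

Section PlaneCurves.
Context {R : realType}.
Local Notation mu := (@lebesgue_measure R).

(** Since [V1] and [V2] are continuous, [vel] agrees with them at every interior point; [acc] is
    then the derivative of [V1], [V2] wherever Lebesgue differentiation provides one. *)
Lemma w22_ae_derivatives (c : curve R) (V1 V2 G1 G2 : R -> R) :
  ac (fun u => (c u).1) V1 -> ac (fun u => (c u).2) V2 -> ac V1 G1 -> ac V2 G2 ->
  {ae mu, forall u : R, 0 <= u <= 1 -> vel c u = (V1 u, V2 u) /\ acc c u = (G1 u, G2 u)}.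
Proof.
move=> c1 c2 v1 v2.
have velE (u : R) : 0 < u < 1 -> vel c u = (V1 u, V2 u).
  move=> u01; rewrite /vel !derive1E.
  rewrite (@derive_val _ _ _ _ _ _ _ (ac_derive c1 (ac_continuous v1) u01)).
  by rewrite (@derive_val _ _ _ _ _ _ _ (ac_derive c2 (ac_continuous v2) u01)).
apply: (@filterS3 _ _ (ae_filter_ringOfSetsType mu) _ _ _ _ _
   ae_interior01 (ac_ae_derive v1) (ac_ae_derive v2)) => u int d1 d2 /int u01.
split; first exact: velE.
rewrite /acc !derive1E; congr pair.
  apply: derive_val; apply: near_is_derive (d1 u01).
  by apply: filterS (itv01_near u01) => t /velE ->.
apply: derive_val; apply: near_is_derive (d2 u01).
by apply: filterS (itv01_near u01) => t /velE ->.
Qed.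

Lemma eucl_ge0 (p : R * R) : 0 <= eucl p. Proof. exact: sqrtr_ge0. Qed.

Lemma eucl_scale (x y m : R) : 0 <= m -> eucl (x * m, y * m) = eucl (x, y) * m.
Proof.
move=> m0; rewrite /eucl/= !exprMn -mulrDl sqrtrM ?addr_ge0 ?sqr_ge0//.
by rewrite sqrtr_sqr ger0_norm.
Qed.

Lemma eucl_eq0 (p : R * R) : (eucl p == 0) = (p == (0, 0)).
Proof.
case: p => x y; rewrite /eucl/= sqrtr_eq0 xpair_eqE.
by rewrite le_eqVlt ltNge addr_ge0 ?sqr_ge0// orbF paddr_eq0 ?sqr_ge0// !sqrf_eq0.
Qed.


Section Energy.
Variables (lam : R) (c : curve R) (V1 V2 G1 G2 b : R -> R).
Hypothesis lam0 : 0 < lam.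
Hypothesis c1 : ac (fun u => (c u).1) V1.
Hypothesis c2 : ac (fun u => (c u).2) V2.
Hypothesis v1 : ac V1 G1.
Hypothesis v2 : ac V2 G2.
Hypothesis V0 : forall u : R, 0 <= u <= 1 -> (V1 u, V2 u) != (0, 0).

Definition energy_density (u : R) : R :=
  (V1 u * G2 u - V2 u * G1 u) ^+ 2 / eucl (V1 u, V2 u) ^+ 5 + lam * eucl (V1 u, V2 u).

Hypothesis bi : integrable01 b.
Hypothesis hb : forall u : R, 0 <= u <= 1 -> energy_density u <= b u.

(** The majorant [b] is what makes the bending term finite: a real integral takes the value [0] when
    the extended one is infinite, so no energy identity or bound is meaningful before
    integrability. *)
Lemma Elam_density :
  integrable01 energy_density /\ Elam lam c = \int[mu]_(u in `[0, 1]) energy_density u.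
Proof.
pose f u := eucl (V1 u, V2 u).
pose h u := (V1 u * G2 u - V2 u * G1 u) ^+ 2 / f u ^+ 5.
have ep (u : R) : 0 <= u <= 1 -> 0 < f u.
  by move=> u01; rewrite lt_neqAle eucl_ge0 eq_sym eucl_eq0 V0.
have h0 (u : R) : 0 <= h u.
  by rewrite divr_ge0 ?sqr_ge0// exprn_ge0// eucl_ge0.
have cV1 := ac_continuous v1; have cV2 := ac_continuous v2.
have cX n (F : R -> R) : {within `[0, 1], continuous F} -> {within `[0, 1], continuous (fun u => F u ^+ n)}.
  move=> cF u; apply: (@cvg_comp _ _ _ F (fun x => x ^+ n)); first exact: cF.
  exact: exprn_continuous.
have cf : {within `[0, 1], continuous f}.
  move=> u; apply: (@cvg_comp _ _ _ (fun u => V1 u ^+ 2 + V2 u ^+ 2) Num.sqrt).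
    exact: (cvgD (cX 2%N _ cV1 u) (cX 2%N _ cV2 u)).
  exact: sqrt_continuous.
have mG1 : measurable_fun (`[0, 1] : set R) G1.
  by case: v1 => gi _; apply/measurable_EFinP; exact: measurable_int gi.
have mG2 : measurable_fun (`[0, 1] : set R) G2.
  by case: v2 => gi _; apply/measurable_EFinP; exact: measurable_int gi.
have mh : measurable_fun (`[0, 1] : set R) h.
  apply: measurable_funM.
    apply: measurable_funX; apply: measurable_funB; apply: measurable_funM => //;
      exact: within_measurable01.
  have m5 : measurable_fun (`[0, 1] : set R) (fun u => (f u ^+ 5)^-1).
    apply: within_measurable01.
    have c5 := cX 5%N _ cf.
    apply/continuous_within_itvP => //; split.
    - move=> u u01; apply: cvgV.
        rewrite expf_neq0// gt_eqF// ep//.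
        by move: u01; rewrite in_itv/= => /andP[? ?]; rewrite !ltW.
      by have [co _ _] := (continuous_within_itvP _ ltr01).1 c5; exact: co.
    - have [_ cl _] := (continuous_within_itvP _ ltr01).1 c5.
      by apply: cvgV => //; rewrite expf_neq0// gt_eqF// ep// lexx ler01.
    - have [_ _ cr] := (continuous_within_itvP _ ltr01).1 c5.
      by apply: cvgV => //; rewrite expf_neq0// gt_eqF// ep// lexx ler01.
  exact: m5.
have fi : integrable01 f by exact: within_integrable01.
have hi : integrable01 h.
  apply: le_integrable bi => //; first exact/measurable_EFinP.
  move=> u /=; rewrite in_itv/= => u01; rewrite lee_fin ger0_norm//.
  apply: le_trans (ler_norm _); apply: le_trans (hb u01).
  by rewrite /energy_density lerDl mulr_ge0 ?(ltW lam0)// eucl_ge0.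
have lfi : integrable01 (fun u => lam * f u).
  by apply: eq_integrable (integrableZl _ lam fi) => // x _.
split; first by apply: eq_integrable (integrableD _ hi lfi) => // x _.
rewrite /energy_density RintegralD// RintegralZl//.
have ae := w22_ae_derivatives c1 c2 v1 v2.
congr (_ + _ * _).
  apply: ge0_ae_eq_Rintegral => // [u _|u _|].
  - by rewrite divr_ge0 ?sqr_ge0// exprn_ge0// eucl_ge0.
  - exact: h0.
  apply: (@filterS _ _ (ae_filter_ringOfSetsType mu)) ae => u hu u01.
  by have /hu[-> ->] : 0 <= u <= 1 by move: u01; rewrite /= in_itv.
apply: ge0_ae_eq_Rintegral => // [u _|u _|]; [exact: eucl_ge0..|].
apply: (@filterS _ _ (ae_filter_ringOfSetsType mu)) ae => u hu u01.
by have /hu[-> _] : 0 <= u <= 1 by move: u01; rewrite /= in_itv.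
Qed.

Lemma Elam_le : Elam lam c <= \int[mu]_(u in `[0, 1]) b u.
Proof.
by have [ei ->] := Elam_density; apply: le_Rintegral.
Qed.

End Energy.

Lemma W22norm_le (c : curve R) (V1 V2 G1 G2 b : R -> R) :
  ac (fun u => (c u).1) V1 -> ac (fun u => (c u).2) V2 -> ac V1 G1 -> ac V2 G2 ->
  integrable01 b ->
  (forall u : R, 0 <= u <= 1 -> (c u).1 ^+ 2 + (c u).2 ^+ 2 + (V1 u ^+ 2 + V2 u ^+ 2) +
     (G1 u ^+ 2 + G2 u ^+ 2) <= b u) ->
  W22norm c <= Num.sqrt (\int[mu]_(u in `[0, 1]) b u).
Proof.
move=> c1 c2 v1 v2 bi hb; rewrite /W22norm ler_sqrt; last first.
  apply: Rintegral_ge0 => u; rewrite /= in_itv/= => /hb; apply: le_trans.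
  by rewrite !addr_ge0 ?sqr_ge0.
have sq (p : R * R) : eucl p ^+ 2 = p.1 ^+ 2 + p.2 ^+ 2.
  by rewrite sqr_sqrtr// addr_ge0 ?sqr_ge0.
have ae := w22_ae_derivatives c1 c2 v1 v2.
apply: ge0_ae_le_Rintegral => //.
- by move=> u _; rewrite !addr_ge0 ?sqr_ge0.
- move=> u; rewrite /= in_itv/= => /hb; apply: le_trans.
  by rewrite !addr_ge0 ?sqr_ge0.
- apply: (@filterS _ _ (ae_filter_ringOfSetsType mu)) ae => u hu; rewrite [X in X -> _]/= in_itv/= => u01.
  by have [-> ->] := hu u01; rewrite !sq; exact: hb.
Qed.

Lemma W22rep_ac (c v : curve R) : W22rep c v -> exists g1 g2 : R -> R,
  [/\ ac (fun u => (c u).1) (fun u => (v u).1), ac (fun u => (c u).2) (fun u => (v u).2),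
     L2 g1, L2 g2 & ac (fun u => (v u).1) g1 /\ ac (fun u => (v u).2) g2].
Proof.
move=> [g [cv1 [cv2 [g1 [g2 H]]]]]; exists (fun u => (g u).1), (fun u => (g u).2).
split=> //; first 2 last.
- by split; apply: ac_from0; [exact: L2_integrable|move=> t /H[_ [_ []]]|exact: L2_integrable|move=> t /H[_ [_ []]]].
- by apply: ac_from0; [exact: within_integrable01|move=> t /H[]].
- by apply: ac_from0; [exact: within_integrable01|move=> t /H[_ []]].
Qed.

Lemma ac_W22rep (c : curve R) (V1 V2 G1 G2 : R -> R) :
  ac (fun u => (c u).1) V1 -> ac (fun u => (c u).2) V2 -> ac V1 G1 -> ac V2 G2 ->
  L2 G1 -> L2 G2 -> W22rep c (fun u => (V1 u, V2 u)).
Proof.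
move=> c1 c2 v1 v2 l1 l2; exists (fun u => (G1 u, G2 u)) => /=.
do 4 (split; first by [exact: ac_continuous v1|exact: ac_continuous v2|]).
move=> t t01; split; first exact: (acE0 c1).
by split; [exact: (acE0 c2)|split; [exact: (acE0 v1)|exact: (acE0 v2)]].
Qed.

End PlaneCurves.

(** * Arclength parameter, translation of a piece, and expansion of the energy density *)

Section Reparametrization.
Context {R : realType}.
Local Notation mu := (@lebesgue_measure R).

Lemma is_derive_unique (F G : R -> R) (x a b : R) : (\forall t \near x, F t = G t) ->
  is_derive x 1 F a -> is_derive x 1 G b -> a = b.
Proof.
move=> FG dF dG.
by rewrite -(@derive_val _ _ _ _ _ _ _ (near_is_derive FG dF)) (@derive_val _ _ _ _ _ _ _ dG).
Qed.

(** The speed of [gam] has to be absolutely continuous with square integrable derivative. Instead of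
    differentiating a square root, it is written as the scalar product [m] of the velocity with the
    unit tangent of the profile, to which the product rule applies. Both agree inside because the
    velocity is the speed times that tangent, and up to the ends by continuity. *)
Lemma arclength_reparam (k lam T L l : R) (X Y x1 y1 : R -> R) (gam : curve R) :
  elastica_profile k lam T X Y x1 y1 -> A_ell l gam ->
  arclength_param_is gam (fun s => (X s, Y s)) L ->
  exists phi m m1 : R -> R,
    [/\ ac phi m, ac m m1, L2 m1 & forall u : R, 0 <= u <= 1 -> 0 < m u] /\
    [/\ phi 0 = 0, phi 1 = L & forall u : R, 0 <= u <= 1 -> gam u = (X (phi u), Y (phi u))].
Proof.
move=> prof [[v [rep v0]] _] [LE gamE].
have [g1 [g2 [c1 c2 l1 l2 [v1 v2]]]] := W22rep_ac rep.
pose sp u := eucl (v u).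
have cv1 := ac_continuous v1; have cv2 := ac_continuous v2.
have csp : {within `[0, 1], continuous sp}.
  move=> u; apply: (@cvg_comp _ _ _ (fun u => (v u).1 ^+ 2 + (v u).2 ^+ 2) Num.sqrt).
    exact: (cvgD (cvgM (cv1 u) (cv1 u)) (cvgM (cv2 u) (cv2 u))).
  exact: sqrt_continuous.
have sp0 (u : R) : 0 <= u <= 1 -> 0 < sp u.
  by move=> u01; rewrite lt_neqAle eucl_ge0 eq_sym eucl_eq0 v0.
pose phi u := \int[mu]_(s in `[0, u]) eucl (vel gam s).
have phiE (u : R) : 0 <= u <= 1 -> phi u = \int[mu]_(s in `[0, u]) sp s.
  move=> /andP[u0 u1]; apply: ge0_ae_eq_Rintegral => // [s _|s _|]; [exact: eucl_ge0..|].
  apply: (@filterS _ _ (ae_filter_ringOfSetsType mu)) (w22_ae_derivatives c1 c2 v1 v2) => s hs /=.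
  rewrite in_itv/= => /andP[s0 su]; have [|-> _] := hs _; first by rewrite s0 (le_trans su).
  by rewrite -surjective_pairing.
have phi0 : phi 0 = 0 by rewrite /phi set_itv1 Rintegral_set1.
have acphi : ac phi sp.
  by apply: ac_from0; [exact: within_integrable01|move=> t t01; rewrite phi0 add0r phiE].
have gE (u : R) : 0 <= u <= 1 -> gam u = (X (phi u), Y (phi u)) by exact: gamE.
have dx1 := prof_dx1 prof; have dy1 := prof_dy1 prof.
have cx1 := is_derive_continuous dx1; have cy1 := is_derive_continuous dy1.
have cY := is_derive_continuous (prof_dY prof).
have cx2 : continuous (fun s => k * Y s * y1 s).
  by move=> s; exact: (cvgM (cvgM (cvg_cst k) (cY s)) (cy1 s)).
have cy2 : continuous (fun s => - (k * Y s * x1 s)).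
  by move=> s; exact: (cvgN (cvgM (cvgM (cvg_cst k) (cY s)) (cx1 s))).
have aX := ac_comp (prof_dX prof) cx1 acphi csp.
have aY := ac_comp (prof_dY prof) cy1 acphi csp.
have ax1 := ac_comp dx1 cx2 acphi csp.
have ay1 := ac_comp dy1 cy2 acphi csp.
pose m u := (v u).1 * x1 (phi u) + (v u).2 * y1 (phi u).
have am := acD (acM v1 ax1) (acM v2 ay1).
have cX1 : {within `[0, 1], continuous (fun u => x1 (phi u) * sp u)}.
  exact: within01M (ac_continuous ax1) csp.
have cY1 : {within `[0, 1], continuous (fun u => y1 (phi u) * sp u)}.
  exact: within01M (ac_continuous ay1) csp.
have mE : forall u : R, 0 <= u <= 1 -> sp u = m u.
  apply: continuous_eq01 => //; first exact: ac_continuous am.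
  move=> u u01.
  have near1 : \forall t \near u, (gam t).1 = X (phi t).
    by apply: filterS (itv01_near u01) => t /andP[t0 t1]; rewrite gE// !ltW.
  have near2 : \forall t \near u, (gam t).2 = Y (phi t).
    by apply: filterS (itv01_near u01) => t /andP[t0 t1]; rewrite gE// !ltW.
  have e1 := is_derive_unique near1 (ac_derive c1 cv1 u01) (ac_derive aX cX1 u01).
  have e2 := is_derive_unique near2 (ac_derive c2 cv2 u01) (ac_derive aY cY1 u01).
  rewrite /m e1 e2 (_ : _ + _ = sp u * (x1 (phi u) ^+ 2 + y1 (phi u) ^+ 2)); last by ring.
  by rewrite (prof_unit prof) mulr1.
have [Mx HMx] := bounded_within (ac_continuous ax1).
have [My HMy] := bounded_within (ac_continuous ay1).
have kY : {within `[0, 1], continuous (fun u => k * Y (phi u))}.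
  by apply: (@within01M _ (fun=> k)); [exact: within01C|exact: ac_continuous aY].
have bx : {within `[0, 1], continuous (fun u => k * Y (phi u) * y1 (phi u) * sp u * (v u).1)}.
  by apply: within01M cv1; apply: within01M csp; exact: within01M kY (ac_continuous ay1).
have by_ : {within `[0, 1], continuous (fun u => - (k * Y (phi u) * x1 (phi u)) * sp u * (v u).2)}.
  apply: within01M cv2; apply: within01M csp; apply: within01N.
  exact: within01M kY (ac_continuous ax1).
have [Bx HBx] := bounded_within bx.
have [By HBy] := bounded_within by_.
exists phi, m, (fun u => g1 u * x1 (phi u) + k * Y (phi u) * y1 (phi u) * sp u * (v u).1 +
  (g2 u * y1 (phi u) + - (k * Y (phi u) * x1 (phi u)) * sp u * (v u).2)).
split; split=> //.
- by apply: eq_ac acphi.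
- apply: L2D; apply: L2D.
  + exact: L2M (within_measurable01 (ac_continuous ax1)) HMx l1.
  + exact: L2_bounded (within_measurable01 bx) HBx.
  + exact: L2M (within_measurable01 (ac_continuous ay1)) HMy l2.
  + exact: L2_bounded (within_measurable01 by_) HBy.
- by move=> u u01; rewrite -mE// sp0.
Qed.

Section Shift.
Variables (phi m m1 : R -> R) (a b T eps : R).
Hypothesis acphi : ac phi m.
Hypothesis acm : ac m m1.
Hypothesis a0 : 0 <= a.
Hypothesis ab : a <= b.
Hypothesis b1 : b <= 1.
Hypothesis phia : phi a = eps.
Hypothesis phib : phi b = T + eps.

(** The competitor translates the arclength interval [[eps, T + eps]]: there it follows
    the original curve at arclength [s - 2 * eps]. *)
Definition cut_param (u : R) : R := if a <= u <= b then phi u - 2 * eps else phi u.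

(** Displacement in the coordinate [W] caused by the translation. The added constant makes it vanish
    at [eps], and also at [T + eps] when [W] gains a fixed amount over each period. *)
Definition shift_dif (W : R -> R) (s : R) : R := W (s - 2 * eps) - W s + (W eps - W (- eps)).

Lemma is_derive_dif (W w : R -> R) (c s : R) : (forall x : R, is_derive x 1 W (w x)) ->
  is_derive s 1 (fun s => W (s - 2 * eps) - W s + c) (w (s - 2 * eps) - w s).
Proof.
move=> dW; have d1 := @is_derive1_shift R W (- (2 * eps)) s _ (dW _).
apply: is_derive_eq (is_deriveD (is_deriveB d1 (dW s)) (is_derive_cst c s 1)) _.
by rewrite addr0.
Qed.

Variables (W w1 w2 : R -> R).
Hypothesis dW : forall s : R, is_derive s 1 W (w1 s).
Hypothesis dw1 : forall s : R, is_derive s 1 w1 (w2 s).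
Hypothesis cw2 : continuous w2.
Hypothesis w1N : forall s : R, w1 (- s) = w1 s.
Hypothesis w1T : forall s : R, w1 (s + T) = w1 s.

Lemma continuous_dif (w : R -> R) : continuous w -> continuous (fun s => w (s - 2 * eps) - w s).
Proof.
move=> cw s; apply: cvgB; last exact: cw.
apply: (@cvg_comp _ _ _ (fun s => s - 2 * eps) w); last exact: cw.
exact: (cvgB cvg_id (cvg_cst _)).
Qed.

Lemma shift_ac1 : ac (fun u => shift_dif W (phi (clamp a b u)))
  (fun u => (w1 (cut_param u) - w1 (phi u)) * m u).
Proof.
have cw1 := is_derive_continuous dw1.
have := ac_clamp a0 ab b1 (ac_comp (fun s => is_derive_dif (W eps - W (- eps)) s dW)
  (continuous_dif cw1) acphi (ac_continuous acm)).
apply: eq_ac => // u _; rewrite patchE /cut_param.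
have [|] := boolP (a <= u <= b) => h; first by rewrite mem_set.
by rewrite memNset ?subrr ?mul0r// /= in_itv; exact/negP.
Qed.

(** Evenness and [T]-periodicity of [w1] make the difference vanish at both cuts, so clamping
    describes it on all of [[0, 1]]. Only the second derivative jumps, which [W^{2,2}] allows. *)
Lemma shift_ac2 : ac (fun u => (w1 (cut_param u) - w1 (phi u)) * m u)
  (fun u => (w2 (cut_param u) - w2 (phi u)) * m u ^+ 2 + (w1 (cut_param u) - w1 (phi u)) * m1 u).
Proof.
have dd (s : R) : is_derive s 1 (fun s => w1 (s - 2 * eps) - w1 s) (w2 (s - 2 * eps) - w2 s).
  have -> : (fun s => w1 (s - 2 * eps) - w1 s) = (fun s => w1 (s - 2 * eps) - w1 s + 0).
    by apply/funext => y; rewrite addr0.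
  exact: is_derive_dif.
have E (u : R) : w1 (phi (clamp a b u) - 2 * eps) - w1 (phi (clamp a b u)) = w1 (cut_param u) - w1 (phi u).
  rewrite /cut_param; have [h|] := boolP (a <= u <= b); first by rewrite clamp_id.
  rewrite negb_and -!ltNge subrr => /orP[h|h].
    rewrite (clamp_le ab (ltW h)) phia (_ : eps - 2 * eps = - eps); last by lra.
    by rewrite w1N subrr.
  rewrite (clamp_ge ab (ltW h)) phib (_ : T + eps - 2 * eps = - eps + T); last by lra.
  by rewrite [T + eps]addrC !w1T w1N subrr.
have := acM (ac_clamp a0 ab b1 (ac_comp dd (continuous_dif cw2) acphi (ac_continuous acm))) acm.
apply: eq_ac => u _; rewrite E// patchE /cut_param.
have [|] := boolP (a <= u <= b) => h; first by rewrite mem_set// expr2; ring.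
rewrite memNset ?subrr ?mul0r//; last by rewrite /= in_itv; exact/negP.
by ring.
Unshelve. all: by end_near. Qed.

End Shift.

Lemma derive_lipschitz (f f' : R -> R) (M x y : R) : (forall s : R, is_derive s 1 f (f' s)) ->
  (forall s : R, `|f' s| <= M) -> `|f x - f y| <= M * `|x - y|.
Proof.
move=> df fM; wlog yx : x y / y <= x.
  move=> h; have [|/ltW] := leP y x; first exact: h.
  by move=> /h; rewrite distrC [`|y - x|]distrC.
have [|c _ ->] := @MVT_segment _ f f' y x yx (fun s _ => df s).
  by apply: continuous_subspaceT; exact: is_derive_continuous df.
by rewrite normrM ler_wpM2r.
Qed.

(** First order expansion of [(1 + s)^(-5/2)] with a generous quadratic remainder, where
    [s = r^2 - 1]. *)
Lemma inv5_le (r : R) : 0 < r -> `|r ^+ 2 - 1| <= 1 / 2 ->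
  (r ^+ 5)^-1 <= 1 - 5 / 2 * (r ^+ 2 - 1) + 100 * (r ^+ 2 - 1) ^+ 2.
Proof.
move=> r0; set s := r ^+ 2 - 1 => /ler_normlP[h1 h2].
have rs : r ^+ 2 = 1 + s by rewrite /s; lra.
(* The second factor is a polynomial lower bound of [r], the square root of [1 + s], so [P <= r^5]
   and the claim becomes a polynomial inequality. *)
pose P := (1 + s) ^+ 2 * (1 + s / 2 - s ^+ 2 / 2).
have h3 : 5 / 8 <= 1 + s / 2 - s ^+ 2 / 2 by nra.
have P8 : 1 / 8 <= P.
  have : 1 / 4 <= (1 + s) ^+ 2 by nra.
  rewrite /P; nra.
have rP : P <= r ^+ 5.
  have -> : r ^+ 5 = (1 + s) ^+ 2 * r by rewrite -rs; ring.
  rewrite ler_wpM2l ?sqr_ge0// -ler_sqr ?nnegrE ?(ltW r0)//; last by lra.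
  rewrite rs.
  have : 0 <= s ^+ 2 * (3 / 4 + s / 2 - s ^+ 2 / 4) by rewrite mulr_ge0 ?sqr_ge0//; nra.
  nra.
have P0 : 0 < P by lra.
apply: (@le_trans _ _ P^-1); first by rewrite lef_pV2 ?posrE ?exprn_gt0.
rewrite -(ler_pM2l P0) mulfV ?gt_eqF//.
have -> : P * (1 - 5 / 2 * s + 100 * s ^+ 2) =
  1 + s ^+ 2 * (100 * P - 19 / 4 - 17 / 4 * s + 3 / 4 * s ^+ 2 + 5 / 4 * s ^+ 3).
  by rewrite /P; field.
rewrite lerDl mulr_ge0 ?sqr_ge0//.
have s3 : - (1 / 8) <= s ^+ 3.
  rewrite exprS; have := sqr_ge0 s; nra.
have := sqr_ge0 s; nra.
Qed.

(** [D] bounds the change of the curvature numerator per unit of [t], and [Z] bounds the change of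
    the squared speed per unit of [t]. The formula adds up crude bounds of the quadratic terms. *)
Definition density_const (lam L B : R) : R :=
  let D := 2 + L * B in let Z := 2 * L + L ^+ 2 in
  D ^+ 2 + 5 / 2 * (Z * (2 * B * D + D ^+ 2)) + 100 * (Z ^+ 2 * (B + D) ^+ 2) + lam * L ^+ 2.

Lemma sqr_le_sqr (x y : R) : `|x| <= y -> x ^+ 2 <= y ^+ 2.
Proof.
move=> xy; rewrite -[x ^+ 2]real_normK ?num_real// ler_pXn2r// nnegrE.
exact: le_trans xy.
Qed.

Lemma normM_le (x y a b : R) : `|x| <= a -> `|y| <= b -> `|x * y| <= a * b.
Proof. by move=> xa yb; rewrite normrM ler_pM. Qed.

Lemma normD_le (x y a b : R) : `|x| <= a -> `|y| <= b -> `|x + y| <= a + b.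
Proof. by move=> xa yb; apply: le_trans (ler_normD _ _) _; exact: lerD. Qed.

(** Expansion in [t] of the energy density at a point with unit tangent [(x, y)] and curvature [kp],
    perturbed by a vertical field with first derivative [A] and second derivative [- 2]. The
    numerator is [kp + t * d] and the squared speed is [1 + t * z]. *)
Lemma density_le (lam L B t x y kp A : R) : 0 <= lam -> 0 <= L -> 0 <= B ->
  x ^+ 2 + y ^+ 2 = 1 -> `|kp| <= B -> `|A| <= L ->
  `|t| <= 1 -> `|t| * (2 * L + L ^+ 2) <= 1 / 2 ->
  (x * (kp * x - 2 * t) - (y + t * A) * (- (kp * y))) ^+ 2 / eucl (x, y + t * A) ^+ 5
   + lam * eucl (x, y + t * A) <=
  kp ^+ 2 + lam + t * (- 4 * kp * x + (lam - 3 * kp ^+ 2) * (y * A)) +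
  density_const lam L B * t ^+ 2.
Proof.
move=> lam0 L0 B0 xy kB AL t1 tZ.
set r := eucl _; pose z := 2 * y * A + t * A ^+ 2; pose d := - 2 * x + A * kp * y.
pose D := 2 + L * B; pose Z := 2 * L + L ^+ 2.
have x1 : `|x| <= 1 by rewrite ler_norml; apply/andP; split; have := sqr_ge0 y; nra.
have y1 : `|y| <= 1 by rewrite ler_norml; apply/andP; split; have := sqr_ge0 x; nra.
have n2 : `|2 : R| <= 2 by rewrite ger0_norm.
have A2 : `|A ^+ 2| <= L ^+ 2 by rewrite normrX ler_pXn2r ?nnegrE.
have zZ : `|z| <= Z.
  apply: normD_le; last by have := normM_le t1 A2; rewrite mul1r.
  by have := normM_le (normM_le n2 y1) AL; rewrite mulr1.
have dD : `|d| <= D.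
  apply: normD_le; first by have := normM_le n2 x1; rewrite mulr1 mulNr normrN.
  by have := normM_le (normM_le AL kB) y1; rewrite mulr1.
have szZ : `|t * z| <= 1 / 2.
  by rewrite normrM; apply: le_trans tZ; rewrite ler_wpM2l.
have r2 : r ^+ 2 = 1 + t * z.
  rewrite /r /eucl/= sqr_sqrtr ?addr_ge0 ?sqr_ge0// -xy /z; ring.
have r0 : 0 < r.
  rewrite lt_neqAle eucl_ge0 andbT eq_sym; apply/eqP => rE.
  by move: r2 szZ; rewrite rE expr0n/= => E; rewrite ler_norml => /andP[]; lra.
have E1 : x * (kp * x - 2 * t) - (y + t * A) * (- (kp * y)) = kp + t * d.
  by rewrite /d -[X in _ = X + _]mulr1 -xy; ring.
have i5 : (r ^+ 5)^-1 <= 1 - 5 / 2 * (t * z) + 100 * (t * z) ^+ 2.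
  by have := inv5_le r0; rewrite r2 addrAC subrr add0r; exact.
have rle : r <= 1 + t * z / 2 by have := sqr_ge0 (r - 1); nra.
rewrite E1.
apply: (@le_trans _ _ ((kp + t * d) ^+ 2 * (1 - 5 / 2 * (t * z) + 100 * (t * z) ^+ 2) +
   lam * (1 + t * z / 2))).
  by apply: lerD; [rewrite ler_wpM2l ?sqr_ge0|rewrite ler_wpM2l].
pose W := d ^+ 2 + (- (5 / 2 * (z * (2 * kp * d + t * d ^+ 2)))) + 100 * (z ^+ 2 * (kp + t * d) ^+ 2).
have -> : (kp + t * d) ^+ 2 * (1 - 5 / 2 * (t * z) + 100 * (t * z) ^+ 2) + lam * (1 + t * z / 2) =
  kp ^+ 2 + lam + t * (- 4 * kp * x + (lam - 3 * kp ^+ 2) * (y * A)) +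
  (W + lam * A ^+ 2 / 2 - 5 / 2 * kp ^+ 2 * A ^+ 2) * t ^+ 2.
  by rewrite /W /d /z; field.
rewrite lerD2l ler_wpM2r ?sqr_ge0//.
have d2 : `|d ^+ 2| <= D ^+ 2 by rewrite normrX ler_pXn2r ?nnegrE// (le_trans _ dD).
have z2 : `|z ^+ 2| <= Z ^+ 2 by rewrite normrX ler_pXn2r ?nnegrE// (le_trans _ zZ).
have td : `|t * d| <= D by have := normM_le t1 dD; rewrite mul1r.
have kd : `|(kp + t * d) ^+ 2| <= (B + D) ^+ 2.
  have h := normD_le kB td.
  by rewrite normrX ler_pXn2r ?nnegrE// (le_trans _ h).
have td2 : `|t * d ^+ 2| <= D ^+ 2 by have := normM_le t1 d2; rewrite mul1r.
have w2 := normM_le zZ (normD_le (normM_le (normM_le n2 kB) dD) td2).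
have w3 := normM_le z2 kd.
have WD : W <= D ^+ 2 + 5 / 2 * (Z * (2 * B * D + D ^+ 2)) + 100 * (Z ^+ 2 * (B + D) ^+ 2).
  rewrite /W; apply: lerD; first apply: lerD.
  - exact: le_trans (ler_norm _) d2.
  - by rewrite -mulrN ler_wpM2l// (le_trans _ w2)// -normrN ler_norm.
  - by rewrite ler_wpM2l// (le_trans (ler_norm _) w3).
have A2' : A ^+ 2 <= L ^+ 2 := le_trans (ler_norm _) A2.
rewrite /density_const -/D -/Z.
have h1 : lam * A ^+ 2 <= lam * L ^+ 2 by rewrite ler_wpM2l.
have h2 : 0 <= lam * A ^+ 2 by rewrite mulr_ge0 ?sqr_ge0.
have h3 : 0 <= kp ^+ 2 * A ^+ 2 by rewrite mulr_ge0 ?sqr_ge0.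
lra.
Qed.

End Reparametrization.

(** * The competitor and the strict decrease of the energy *)

Section Competitor.
Context {R : realType}.
Local Notation mu := (@lebesgue_measure R).

Lemma L2_dominated (f g : R -> R) (c d : R) : measurable_fun (`[0, 1] : set R) f -> L2 g ->
  (forall u : R, 0 <= u <= 1 -> `|f u| <= c + d * `|g u|) -> L2 f.
Proof.
move=> mf [mg g2] fg; split=> //.
have ci : integrable01 (fun=> 2 * c ^+ 2) by apply: within_integrable01; exact: within01C.
have gi : integrable01 (fun u => 2 * d ^+ 2 * g u ^+ 2).
  by apply: eq_integrable (integrableZl _ (2 * d ^+ 2) g2) => // u _.
apply: le_integrable (integrableD _ ci gi) => //.
  by apply/measurable_EFinP; exact: measurable_funX.
move=> u; rewrite /= in_itv/= => u01; rewrite lee_fin !ger0_norm ?sqr_ge0//; last first.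
  by have h1 := sqr_ge0 c; have h2 := mulr_ge0 (sqr_ge0 d) (sqr_ge0 (g u)); lra.
apply: le_trans (sqr_le_sqr (fg u u01)) _.
rewrite -[g u ^+ 2]real_normK ?num_real//.
have := sqr_ge0 (c - d * `|g u|); nra.
Qed.

Lemma ac_measurable (F f : R -> R) : ac F f -> measurable_fun (`[0, 1] : set R) f.
Proof. by move=> [fi _]; apply/measurable_EFinP; exact: measurable_int fi. Qed.

Lemma ac_le (F f : R -> R) (s u : R) : ac F f -> (forall x : R, 0 <= x <= 1 -> 0 <= f x) ->
  0 <= s -> s <= u -> u <= 1 -> F s <= F u.
Proof.
move=> [_ FE] f0 s0 su u1; rewrite -subr_ge0 FE//; apply: Rintegral_ge0 => x.
by rewrite /= in_itv/= => /andP[sx xu]; rewrite f0// (le_trans s0)//= (le_trans xu).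
Qed.

(** Caratheodory's form of the derivative: [G x = g x * x] with [g] continuous at [0] and
    [g 0 = d]. *)
Lemma is_derive_neq0 (G : R -> R) (d e : R) : is_derive (0 : R) 1 G d -> G 0 = 0 -> d != 0 ->
  0 < e -> exists2 x : R, 0 < x < e & G x != 0.
Proof.
move=> dG G0 d0 e0; have [g [gE cg g0]] := (is_derive1_caratheodory _ _ _).1 dG.
have gn : \forall x \near 0, g x != 0.
  have cg' : g x @[x --> (0 : R)] --> d by rewrite -g0; exact: cg.
  exact: (cvgr_neq0 d cg' d0).
have [r /= r0 hr] := gn.
exists (Num.min (e / 2) (r / 2)).
  by rewrite lt_min !divr_gt0//= gt_min; apply/orP; left; lra.
have x0 : 0 < Num.min (e / 2) (r / 2) by rewrite lt_min !divr_gt0.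
have xr : Num.min (e / 2) (r / 2) < r by rewrite gt_min; apply/orP; right; lra.
have := gE (Num.min (e / 2) (r / 2)); rewrite G0 !subr0 => ->.
rewrite mulf_neq0 ?(gt_eqF x0)//.
by apply: hr; rewrite /= sub0r normrN gtr0_norm.
Qed.

Variables (k lam T L l : R) (X Y x1 y1 : R -> R) (gam : curve R) (phi m m1 : R -> R).
Hypothesis lam0 : 0 < lam.
Hypothesis prof : elastica_profile k lam T X Y x1 y1.
Hypothesis acphi : ac phi m.
Hypothesis acm : ac m m1.
Hypothesis l2m1 : L2 m1.
Hypothesis m0 : forall u : R, 0 <= u <= 1 -> 0 < m u.
Hypothesis phi0 : phi 0 = 0.
Hypothesis phi1 : phi 1 = L.
Hypothesis gE : forall u : R, 0 <= u <= 1 -> gam u = (X (phi u), Y (phi u)).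
Hypothesis gam0 : gam 0 = (0, 0).
Hypothesis gam1 : gam 1 = (l, 0).
Hypothesis TL : T < L.

Let x2 s := k * Y s * y1 s.
Let y2 s := - (k * Y s * x1 s).
(** [B] bounds the curvature, whose square is at most [2 * |k| + lam]; the summand [1] ensures
    [B <= B^2]. Below, [C] is a common Lipschitz constant for the position, the tangent and its
    derivative. *)
Let B : R := 1 + 2 * `|k| + lam.
Let C : R := 1 + B + `|k| + B ^+ 2.

Let k0 : 0 <= `|k|. Proof. exact: normr_ge0. Qed.
Let B1 : 1 <= B. Proof. by rewrite /B; have := k0; have := lam0; lra. Qed.
Let T0 : 0 < T. Proof. exact: prof_T prof. Qed.
Let L0 : 0 < L. Proof. exact: lt_trans T0 TL. Qed.
Let C1 : 1 <= C. Proof. by rewrite /C; have := k0; have := B1; nra. Qed.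

Let Y0 : Y 0 = 0. Proof. by have := prof_YN prof 0; rewrite oppr0; lra. Qed.

Let XL : X L = l /\ Y L = 0.
Proof. by have := gE (_ : 0 <= 1 <= 1); rewrite lexx ler01 phi1 gam1 => /(_ isT)[-> ->]. Qed.

Let X0 : X 0 = 0.
Proof. by have := gE (_ : 0 <= 0 <= 1); rewrite lexx ler01 phi0 gam0 => /(_ isT)[<- _]. Qed.

Let x1_le (s : R) : `|x1 s| <= 1.
Proof.
have := prof_unit prof s; have := sqr_ge0 (y1 s) => h1 h2.
by rewrite ler_norml; apply/andP; split; nra.
Qed.

Let y1_le (s : R) : `|y1 s| <= 1.
Proof.
have := prof_unit prof s; have := sqr_ge0 (x1 s) => h1 h2.
by rewrite ler_norml; apply/andP; split; nra.
Qed.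

Let kY_le (s : R) : `|k * Y s| <= B.
Proof.
have h := prof_curv prof s.
have h1 : k * x1 s <= `|k|.
  apply: le_trans (ler_norm _) _; have := normM_le (lexx `|k|) (x1_le s).
  by rewrite mulr1.
have hB := B1.
have : `|k * Y s| ^+ 2 <= B ^+ 2.
  by rewrite real_normK ?num_real// h /B; have := k0; nra.
by rewrite ler_pXn2r// nnegrE; lra.
Qed.

Let x2_le (s : R) : `|x2 s| <= B.
Proof. by have := normM_le (kY_le s) (y1_le s); rewrite mulr1. Qed.

Let y2_le (s : R) : `|y2 s| <= B.
Proof. by rewrite /y2 normrN; have := normM_le (kY_le s) (x1_le s); rewrite mulr1. Qed.

Let dX := prof_dX prof.
Let dY := prof_dY prof.
Let dx1 : forall s : R, is_derive s 1 x1 (x2 s) := prof_dx1 prof.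
Let dy1 : forall s : R, is_derive s 1 y1 (y2 s) := prof_dy1 prof.

Let cY := is_derive_continuous dY.
Let cx1 := is_derive_continuous dx1.
Let cy1 := is_derive_continuous dy1.

Let dx2 (s : R) : is_derive s 1 x2 (k * y1 s * y1 s + k * Y s * y2 s).
Proof.
have h1 := dY s; have h2 := dy1 s.
by rewrite /x2; apply: is_derive_eq; rewrite /GRing.scale/=; ring.
Qed.

Let dy2 (s : R) : is_derive s 1 y2 (- (k * y1 s * x1 s + k * Y s * x2 s)).
Proof.
have h1 := dY s; have h2 := dx1 s.
by rewrite /y2; apply: is_derive_eq; rewrite /GRing.scale/=; ring.
Qed.

Let cx2 := is_derive_continuous dx2.
Let cy2 := is_derive_continuous dy2.

Let third_le (a b c d : R) : `|a| <= 1 -> `|b| <= 1 -> `|c| <= B -> `|d| <= B ->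
  `|k * a * b + c * d| <= C.
Proof.
move=> ha hb hc hd.
have := normD_le (normM_le (normM_le (lexx `|k|) ha) hb) (normM_le hc hd).
by rewrite !mulr1 /C; have := B1; nra.
Qed.

Let lipX (s r : R) : `|X s - X r| <= C * `|s - r|.
Proof. by apply: derive_lipschitz dX _ => x; exact: le_trans (x1_le x) C1. Qed.
Let lipY (s r : R) : `|Y s - Y r| <= C * `|s - r|.
Proof. by apply: derive_lipschitz dY _ => x; exact: le_trans (y1_le x) C1. Qed.
Let BC : B <= C. Proof. by rewrite /C; have := k0; have := B1; nra. Qed.
Let lipx1 (s r : R) : `|x1 s - x1 r| <= C * `|s - r|.
Proof. by apply: derive_lipschitz dx1 _ => x; exact: le_trans (x2_le x) BC. Qed.
Let lipy1 (s r : R) : `|y1 s - y1 r| <= C * `|s - r|.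
Proof. by apply: derive_lipschitz dy1 _ => x; exact: le_trans (y2_le x) BC. Qed.
Let lipx2 (s r : R) : `|x2 s - x2 r| <= C * `|s - r|.
Proof. by apply: derive_lipschitz dx2 _ => x; exact: third_le. Qed.
Let lipy2 (s r : R) : `|y2 s - y2 r| <= C * `|s - r|.
Proof. by apply: derive_lipschitz dy2 _ => x; rewrite normrN; exact: third_le. Qed.

Let cm := ac_continuous acm.

Let phi_bounds (u : R) : 0 <= u <= 1 -> 0 <= phi u <= L.
Proof.
move=> /andP[u0 u1]; rewrite -{1}phi0 -phi1.
have p (x : R) : 0 <= x <= 1 -> 0 <= m x by move=> /m0/ltW.
by rewrite (ac_le acphi p)//= (ac_le acphi p).
Qed.

Let psi s := s * (L - s).
Let psi1 s := L - 2 * s.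

Let dpsi (s : R) : is_derive s 1 psi (psi1 s).
Proof. by rewrite /psi /psi1; apply: is_derive_eq; rewrite /GRing.scale/=; ring. Qed.

Let dpsi1 (s : R) : is_derive s 1 psi1 (- 2).
Proof. by rewrite /psi1; apply: is_derive_eq; rewrite /GRing.scale/=; ring. Qed.

Let cpsi1 := is_derive_continuous dpsi1.
Let cm2 : continuous (fun _ : R => - 2 : R). Proof. by move=> s; exact: cvg_cst. Qed.

Let psi_le (u : R) : 0 <= u <= 1 -> `|psi (phi u)| <= L ^+ 2.
Proof. by move=> /phi_bounds/andP[h1 h2]; rewrite /psi ger0_norm; nra. Qed.

Let psi1_le (u : R) : 0 <= u <= 1 -> `|psi1 (phi u)| <= L.
Proof. by move=> /phi_bounds/andP[h1 h2]; rewrite /psi1 ler_norml; lra. Qed.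

(** With curvature [kappa = - k * Y], this is [2 * kappa * x1], the coefficient of [psi''] in the
    first variation; [G1] is the coefficient of [psi']. *)
Let G s := - 2 * k * Y s * x1 s.
Let G1 s := (lam - 3 * (k * Y s) ^+ 2) * y1 s.

(** The vertical component of the elastica equation, integrated once. Replacing [lam] through the
    curvature identity turns it into a direct computation. *)
Let dG (s : R) : is_derive s 1 G (G1 s).
Proof.
have h1 := dY s; have h2 := dx1 s.
rewrite /G /G1; apply: is_derive_eq; rewrite /GRing.scale/=.
rewrite (_ : lam = (k * Y s) ^+ 2 - 2 * k * x1 s); last by rewrite (prof_curv prof); ring.
by rewrite /x2; ring.
Qed.

Let cG1 : continuous G1.
Proof.
move=> s; apply: cvgM; last exact: cy1.
apply: cvgB; first exact: cvg_cst.
apply: cvgM; first exact: cvg_cst.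
apply: (@cvg_comp _ _ _ (fun s => k * Y s) (fun x => x ^+ 2)); last exact: exprn_continuous.
by apply: cvgM; [exact: cvg_cst|exact: cY].
Qed.

Let GN (s : R) : G (- s) = - G s.
Proof. by rewrite /G (prof_YN prof) (prof_x1N prof); ring. Qed.

Let GT (s : R) : G (s + T) = G s.
Proof. by rewrite /G (prof_YT prof) (prof_x1T prof). Qed.

Let bX1 := ac_comp dX cx1 acphi cm.
Let bY1 := ac_comp dY cy1 acphi cm.
Let bX2 := acM (ac_comp dx1 cx2 acphi cm) acm.
Let bY2 := acM (ac_comp dy1 cy2 acphi cm) acm.

(** The density [kappa^2 + lam] equals [2 * k * x1 + 2 * lam], so integration only sees the
    horizontal span and the length. *)
Lemma Elam_profile : Elam lam gam = 2 * k * l + 2 * lam * L.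
Proof.
have c1 : ac (fun u => (gam u).1) (fun u => x1 (phi u) * m u).
  by apply: eq_ac bX1 => // u u01; rewrite gE.
have c2 : ac (fun u => (gam u).2) (fun u => y1 (phi u) * m u).
  by apply: eq_ac bY1 => // u u01; rewrite gE.
have V0 (u : R) : 0 <= u <= 1 -> (x1 (phi u) * m u, y1 (phi u) * m u) != (0, 0).
  move=> u01; rewrite xpair_eqE !mulf_eq0 (gt_eqF (m0 u01)) !orbF.
  apply/negP => /andP[/eqP h1 /eqP h2]; have := prof_unit prof (phi u).
  by rewrite h1 h2 expr0n/= addr0 => /esym/eqP; rewrite oner_eq0.
pose b u := 2 * k * (x1 (phi u) * m u) + 2 * lam * m u.
have acb := acD (acZ (2 * k) bX1) (acZ (2 * lam) acphi).
have eb (u : R) : 0 <= u <= 1 -> energy_density lam (fun u => x1 (phi u) * m u) (fun u => y1 (phi u) * m u)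
   (fun x => x2 (phi x) * m x * m x + m1 x * x1 (phi x))
   (fun x => y2 (phi x) * m x * m x + m1 x * y1 (phi x)) u = b u.
  move=> u01; have mu0 := m0 u01; rewrite /energy_density eucl_scale ?(ltW mu0)//.
  have -> : eucl (x1 (phi u), y1 (phi u)) = 1 by rewrite /eucl/= (prof_unit prof) sqrtr1.
  rewrite mul1r /b.
  rewrite (_ : x1 (phi u) * m u * _ - _ =
     m u ^+ 3 * (- (k * Y (phi u))) * (x1 (phi u) ^+ 2 + y1 (phi u) ^+ 2)); last first.
    by rewrite /x2 /y2; ring.
  rewrite (prof_unit prof) mulr1 exprMn sqrrN (prof_curv prof).
  by field; rewrite gt_eqF.
have [|_ ->] := Elam_density lam0 c1 c2 bX2 bY2 V0 acb.1.
  by move=> u u01; rewrite eb.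
rewrite (_ : \int[mu]_(u in _) _ = \int[mu]_(u in `[0, 1]) b u); last first.
  by apply: eq_Rintegral => u /set_mem; rewrite /= in_itv/= => /eb.
rewrite -acb.2// phi1 phi0 XL.1 X0; ring.
Qed.


(** * Admissibility, closeness and energy of the competitor *)

Section Perturbation.
Variables (eps t a b : R).
Hypothesis eps0 : 0 < eps.
Hypothesis a0 : 0 <= a.
Hypothesis ab : a <= b.
Hypothesis b1 : b <= 1.
Hypothesis phia : phi a = eps.
Hypothesis phib : phi b = T + eps.
Hypothesis t1 : `|t| <= 1.
Hypothesis tL : `|t| * (2 * L + L ^+ 2) <= 1 / 2.

Let sig := cut_param phi a b eps.

(** Clamping freezes the displacement outside [[a, b]] at its values at the cuts, which are zero. *)
Definition perturbation : curve R := fun u =>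
  (shift_dif eps X (phi (clamp a b u)), shift_dif eps Y (phi (clamp a b u)) + t * psi (phi u)).

Definition competitor : curve R := Defs.cadd gam perturbation.

Let sX1 := shift_ac1 eps acphi acm a0 ab b1 dX dx1.
Let sY1 := shift_ac1 eps acphi acm a0 ab b1 dY dy1.
Let sX2 := shift_ac2 acphi acm a0 ab b1 phia phib dx1 cx2 (prof_x1N prof) (prof_x1T prof).
Let sY2 := shift_ac2 acphi acm a0 ab b1 phia phib dy1 cy2 (prof_y1N prof) (prof_y1T prof).
Let sP1 := acZ t (ac_comp dpsi cpsi1 acphi cm).
Let sP2 := acZ t (acM (ac_comp dpsi1 cm2 acphi cm) acm).

Let p2 u := y1 (sig u) + t * psi1 (phi u).
Let H1 u := x2 (sig u) * m u ^+ 2 + x1 (sig u) * m1 u.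
Let H2 u := (y2 (sig u) - 2 * t) * m u ^+ 2 + p2 u * m1 u.

Let c1 : ac (fun u => (competitor u).1) (fun u => x1 (sig u) * m u).
Proof.
apply: eq_ac (acD bX1 sX1) => u u01; first by rewrite /competitor /Defs.cadd/= gE.
by rewrite /sig; ring.
Qed.

Let c2 : ac (fun u => (competitor u).2) (fun u => p2 u * m u).
Proof.
apply: eq_ac (acD (acD bY1 sY1) sP1) => u u01.
  by rewrite /competitor /Defs.cadd/= gE// /perturbation/=; ring.
by rewrite /p2 /sig; ring.
Qed.

Let v1 : ac (fun u => x1 (sig u) * m u) H1.
Proof. by apply: eq_ac (acD bX2 sX2) => u u01; rewrite /H1 /sig; ring. Qed.

Let v2 : ac (fun u => p2 u * m u) H2.
Proof. by apply: eq_ac (acD (acD bY2 sY2) sP2) => u u01; rewrite /H2 /p2 /sig; ring. Qed.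

(** Keeps the velocity nonzero: where [x1] vanishes, [y1] has modulus [1], which a term of size
    [1 / 4] cannot cancel. *)
Let tA (u : R) : 0 <= u <= 1 -> `|t * psi1 (phi u)| <= 1 / 4.
Proof.
move=> u01; rewrite normrM.
have h : `|t| * `|psi1 (phi u)| <= `|t| * L by rewrite ler_wpM2l// psi1_le.
have := normr_ge0 t; have := L0; have := tL; nra.
Qed.

Let V0 (u : R) : 0 <= u <= 1 -> (x1 (sig u) * m u, p2 u * m u) != (0, 0).
Proof.
move=> u01; rewrite xpair_eqE !mulf_eq0 (gt_eqF (m0 u01)) !orbF.
apply/negP => /andP[/eqP h1 /eqP h2]; have := prof_unit prof (sig u).
have := tA u01; rewrite ler_norml => /andP[h3 h4].
rewrite h1 expr0n/= add0r (_ : y1 (sig u) = - (t * psi1 (phi u))); last first.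
  by move: h2; rewrite /p2; lra.
by nra.
Qed.

Let mbound : exists2 M : R, 0 <= M & forall u : R, 0 <= u <= 1 -> `|m u| <= M.
Proof.
have [M hM] := bounded_within cm; exists `|M| => // u /hM h.
exact: le_trans h (ler_norm _).
Qed.

Let p2_le (u : R) : 0 <= u <= 1 -> `|p2 u| <= 2.
Proof.
move=> u01; have := normD_le (y1_le (sig u)) (tA u01).
by rewrite -/(p2 u) => h; apply: le_trans h _; lra.
Qed.

Let l2H1 : L2 H1.
Proof.
have [M M0 hM] := mbound.
apply: (@L2_dominated _ m1 (B * M ^+ 2) 1) => //; first exact: ac_measurable v1.
move=> u u01; apply: normD_le; last exact: normM_le (x1_le _) (lexx _).
apply: normM_le (x2_le _) _; rewrite normrX ler_pXn2r ?nnegrE//; exact: hM.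
Qed.

Let l2H2 : L2 H2.
Proof.
have [M M0 hM] := mbound.
apply: (@L2_dominated _ m1 ((B + 2) * M ^+ 2) 2) => //; first exact: ac_measurable v2.
move=> u u01; apply: normD_le; last exact: normM_le (p2_le u01) (lexx _).
apply: normM_le; last by rewrite normrX ler_pXn2r ?nnegrE//; exact: hM.
apply: normD_le (y2_le _) _; rewrite normrN normrM ger0_norm//.
by have := t1; lra.
Qed.

Let sX (W : R -> R) (d : R) : (forall s : R, W (s + T) - W s = d) -> shift_dif eps W (phi b) = 0.
Proof.
move=> WT; rewrite /shift_dif phib.
have h1 := WT (- eps); have h2 := WT eps.
rewrite (_ : T + eps - 2 * eps = - eps + T); last by ring.
by rewrite [T + eps]addrC; lra.
Qed.

Let sX0 (W : R -> R) : shift_dif eps W (phi a) = 0.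
Proof.
rewrite /shift_dif phia (_ : eps - 2 * eps = - eps); last by ring.
by ring.
Qed.

Lemma competitor_A : A_ell l competitor.
Proof.
split; last split.
- exists (fun u => (x1 (sig u) * m u, p2 u * m u)); split; last exact: V0.
  exact: ac_W22rep c1 c2 v1 v2 l2H1 l2H2.
- rewrite /competitor /Defs.cadd /perturbation/= gam0/= (clamp_le ab a0) !sX0 phi0.
  by rewrite /psi mul0r mulr0 !addr0.
- rewrite /competitor /Defs.cadd /perturbation/= gam1/= (clamp_ge ab b1) phi1.
  rewrite (sX (prof_XT prof)) (@sX Y 0); last by move=> s; rewrite (prof_YT prof) subrr.
  by rewrite /psi subrr !mulr0 !addr0.
Qed.

Let sig_phi (u : R) : `|sig u - phi u| <= 2 * eps.
Proof.
rewrite /sig /cut_param; case: ifP => _; last by rewrite subrr normr0 mulr_ge0// ltW.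
by rewrite addrAC subrr add0r normrN ger0_norm// mulr_ge0// ltW.
Qed.

Let lip_sig (w : R -> R) (u : R) : (forall s r : R, `|w s - w r| <= C * `|s - r|) ->
  `|w (sig u) - w (phi u)| <= 2 * C * eps.
Proof.
move=> lw; apply: le_trans (lw _ _) _.
rewrite (_ : 2 * C * eps = C * (2 * eps)); last by ring.
by rewrite ler_wpM2l//; have := C1; lra.
Qed.

Let lip_dif (W : R -> R) (s : R) : (forall s r : R, `|W s - W r| <= C * `|s - r|) ->
  `|shift_dif eps W s| <= 4 * C * eps.
Proof.
move=> lW; have h1 := lW (s - 2 * eps) s; have h2 := lW eps (- eps).
have e2 : `|2 * eps| = 2 * eps by rewrite ger0_norm// mulr_ge0// ltW.
have E1 : s - 2 * eps - s = - (2 * eps) by ring.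
have E2 : eps - - eps = 2 * eps by ring.
have := normD_le h1 h2; rewrite E1 E2 normrN e2 => h; apply: le_trans h _.
by rewrite le_eqVlt; apply/orP; left; apply/eqP; ring.
Qed.

Let Q := 4 * C + L ^+ 2 + L + 2.
Let kap := eps + `|t|.

(** Free of [eps] and [t], so it is available before they are chosen. The term in [m1] is kept under
    the integral because [m1] is only square integrable. *)
Definition norm_const (M : R) : R := \int[mu]_(u in `[0, 1]) (Q ^+ 2 * (2 + 2 * M ^+ 2 + 4 * M ^+ 4 + 4 * m1 u ^+ 2)).

Lemma competitor_norm (M : R) : (forall u : R, 0 <= u <= 1 -> `|m u| <= M) ->
  W22norm (Defs.csub competitor gam) <= Num.sqrt (kap ^+ 2 * norm_const M).
Proof.
move=> hM; have L0' := L0; have C1' := C1; have t0 := normr_ge0 t; have e0 := ltW eps0.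
have hk : 0 <= kap by rewrite /kap addr_ge0.
have d1 : ac (fun u => (Defs.csub competitor gam u).1) (fun u => (x1 (sig u) - x1 (phi u)) * m u).
  by apply: eq_ac sX1 => // u _; rewrite /Defs.csub /Defs.cadd /Defs.cscale /competitor /perturbation/=; ring.
have d2 : ac (fun u => (Defs.csub competitor gam u).2)
    (fun u => (y1 (sig u) - y1 (phi u)) * m u + t * (psi1 (phi u) * m u)).
  apply: eq_ac (acD sY1 sP1) => // u _.
  by rewrite /Defs.csub /Defs.cadd /Defs.cscale /competitor /perturbation/=; ring.
have i2 : integrable01 (fun u => m1 u ^+ 2) by case: l2m1.
have bi : integrable01 (fun u => Q ^+ 2 * (2 + 2 * M ^+ 2 + 4 * M ^+ 4 + 4 * m1 u ^+ 2)).
  have i0 : integrable01 (fun=> Q ^+ 2 * (2 + 2 * M ^+ 2 + 4 * M ^+ 4)).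
    by apply: within_integrable01; exact: within01C.
  apply: eq_integrable (integrableD _ i0 (integrableZl _ (Q ^+ 2 * 4) i2)) => // u _ /=.
  by rewrite -EFinM -EFinD; congr EFin; ring.
rewrite /norm_const -RintegralZl//.
have M0 : 0 <= M by apply: le_trans (hM 0 _); rewrite ?lexx ?ler01.
have Ck : 4 * C * eps <= Q * kap.
  by rewrite /Q /kap; have := L0'; nra.
have Lk (c : R) : 0 <= c -> c <= L ^+ 2 + L + 2 -> `|t| * c + 4 * C * eps <= Q * kap.
  by move=> c0 cl; rewrite /Q /kap; nra.
have Q0 : 0 <= Q by rewrite /Q; nra.
apply: (W22norm_le d1 d2 sX2 (acD sY2 sP2)).
  by apply: eq_integrable (integrableZl _ (kap ^+ 2) bi) => // u _.
move=> u u01 /=.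
have mM := hM _ u01.
have m2M : `|m u ^+ 2| <= M ^+ 2 by rewrite normrX ler_pXn2r ?nnegrE.
set z1 := (_ + -1 * (gam u).1); set z2 := (_ + -1 * (gam u).2).
have b1' : `|z1| <= Q * kap.
  apply: le_trans Ck.
  rewrite (_ : z1 = shift_dif eps X (phi (clamp a b u))); first exact: lip_dif lipX.
  by rewrite /z1; ring.
have b2' : `|z2| <= Q * kap.
  rewrite (_ : z2 = t * psi (phi u) + shift_dif eps Y (phi (clamp a b u))); last first.
    by rewrite /z2; ring.
  apply: le_trans (normD_le (normM_le (lexx _) (psi_le u01)) (lip_dif _ lipY)) _.
  by apply: Lk; [exact: sqr_ge0|lra].
have e1 : `|x1 (sig u) - x1 (phi u)| <= Q * kap.
  by apply: le_trans (lip_sig u lipx1) _; apply: le_trans Ck; nra.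
have e2 : `|x2 (sig u) - x2 (phi u)| <= Q * kap.
  by apply: le_trans (lip_sig u lipx2) _; apply: le_trans Ck; nra.
have e3 : `|y1 (sig u) - y1 (phi u) + t * psi1 (phi u)| <= Q * kap.
  apply: le_trans (normD_le (lip_sig u lipy1) (normM_le (lexx _) (psi1_le u01))) _.
  have := Lk L (ltW L0') ltac:(nra); nra.
have e4 : `|y2 (sig u) - y2 (phi u) + t * (- 2)| <= Q * kap.
  have n2 : `|- 2 : R| <= 2 by rewrite normrN ger0_norm.
  apply: le_trans (normD_le (lip_sig u lipy2) (normM_le (lexx _) n2)) _.
  have := Lk 2 ltac:(lra) ltac:(nra); nra.
have f1 := sqr_le_sqr b1'; have f2 := sqr_le_sqr b2'.
have f3 := sqr_le_sqr (normM_le e1 mM).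
have f4 := sqr_le_sqr (normM_le e3 mM).
have f5 := sqr_le_sqr (normD_le (normM_le e2 m2M) (normM_le e1 (lexx `|m1 u|))).
have f6 := sqr_le_sqr (normD_le (normM_le e4 m2M) (normM_le e3 (lexx `|m1 u|))).
have g5 : (Q * kap * M ^+ 2 + Q * kap * `|m1 u|) ^+ 2 <= (Q * kap) ^+ 2 * (2 * M ^+ 4 + 2 * m1 u ^+ 2).
  rewrite -[m1 u ^+ 2]real_normK ?num_real// -mulrDr exprMn ler_wpM2l ?sqr_ge0//.
  by have := sqr_ge0 (M ^+ 2 - `|m1 u|); rewrite (_ : M ^+ 4 = (M ^+ 2) ^+ 2) -?exprM//; nra.
rewrite (_ : kap ^+ 2 * _ = (Q * kap) ^+ 2 + (Q * kap) ^+ 2 + ((Q * kap * M) ^+ 2 + (Q * kap * M) ^+ 2)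
  + ((Q * kap) ^+ 2 * (2 * M ^+ 4 + 2 * m1 u ^+ 2) + (Q * kap) ^+ 2 * (2 * M ^+ 4 + 2 * m1 u ^+ 2))); last by ring.
apply: lerD; [apply: lerD; apply: lerD => //|apply: lerD].
- by rewrite (_ : _ + _ = (y1 (sig u) - y1 (phi u) + t * psi1 (phi u)) * m u)//; ring.
- exact: le_trans f5 g5.
- apply: le_trans g5; rewrite (_ : _ + _ = (y2 (sig u) - y2 (phi u) + t * - 2) * m u ^+ 2 +
    (y1 (sig u) - y1 (phi u) + t * psi1 (phi u)) * m1 u)//; ring.
Qed.

Let Kc := density_const lam L B.

(* [G' psi' + G psi''] integrates to the jumps of [G psi'] at the two cuts. *)
Lemma competitor_energy :
  Elam lam competitor <= 2 * k * l + 2 * lam * L + t * (4 * T * G eps) + Kc * L * t ^+ 2.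
Proof.
pose h u := G (sig u) * (- 2) + G1 (sig u) * psi1 (phi u).
have dGd (s : R) : is_derive s 1 (fun s => G (s - 2 * eps) - G s) (G1 (s - 2 * eps) - G1 s).
  have -> : (fun s => G (s - 2 * eps) - G s) = (fun s => G (s - 2 * eps) - G s + 0).
    by apply/funext => y; rewrite addr0.
  exact: is_derive_dif.
have aP := ac_comp dpsi1 cm2 acphi cm.
have aG := acM (ac_comp dG cG1 acphi cm) aP.
have aD := ac_clamp a0 ab b1 (acM (ac_comp dGd (@continuous_dif R eps _ cG1) acphi cm) aP).
have ah := acD aG aD.
(* An explicit primitive of the upper bound [bd]. The clamped term replaces [G (phi u)] by its value
   on the translated piece between the cuts. *)
pose F u := 2 * k * (competitor u).1 + (2 * lam + Kc * t ^+ 2) * phi u +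
  t * (G (phi u) * psi1 (phi u) +
    (G (phi (clamp a b u) - 2 * eps) - G (phi (clamp a b u))) * psi1 (phi (clamp a b u))).
pose bd u := 2 * k * (x1 (sig u) * m u) + (2 * lam + Kc * t ^+ 2) * m u + t * (h u * m u).
have aF : ac F bd.
  apply: eq_ac (acD (acD (acZ (2 * k) c1) (acZ (2 * lam + Kc * t ^+ 2) acphi)) (acZ t ah)) => // u _.
  rewrite /bd /h; congr (_ + t * _); rewrite patchE /sig /cut_param.
  have [|] := boolP (a <= u <= b) => hu; first by rewrite mem_set//; ring.
  by rewrite memNset ?addr0; [ring|rewrite /= in_itv; exact/negP].
have -> : 2 * k * l + 2 * lam * L + t * (4 * T * G eps) + Kc * L * t ^+ 2 =
    \int[mu]_(u in `[0, 1]) bd u.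
  rewrite -aF.2// /F (clamp_le ab a0) (clamp_ge ab b1) phia phib phi0 phi1.
  have [_ [-> ->]] := competitor_A; rewrite /=.
  have GL : G L = 0 by rewrite /G XL.2 mulr0 mul0r.
  have G0 : G 0 = 0 by rewrite /G Y0 mulr0 mul0r.
  (* The end terms vanish with the height, and the cuts leave
     [2 * G eps * (psi1 eps - psi1 (T + eps))], which is [4 * T * G eps]. *)
  rewrite GL G0 (_ : eps - 2 * eps = - eps); last by ring.
  rewrite (_ : T + eps - 2 * eps = - eps + T); last by ring.
  rewrite [T + eps]addrC !GT GN /psi1; ring.
apply: (Elam_le lam0 c1 c2 v1 v2 V0 aF.1) => u u01.
have mu0 := m0 u01; rewrite /energy_density eucl_scale ?(ltW mu0)//.
set r := eucl _.
have r0 : 0 < r.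
  rewrite lt_neqAle eucl_ge0 andbT eq_sym eucl_eq0; have := V0 u01.
  by apply: contra => /eqP[-> ->]; rewrite !mul0r.
have := density_le (ltW lam0) (ltW L0) (le_trans ler01 B1) (prof_unit prof (sig u))
  (_ : `|- (k * Y (sig u))| <= B) (psi1_le u01) t1 tL.
rewrite normrN => /(_ (kY_le _)).
rewrite -/(p2 u) -/r => hd.
(* The terms in [m1] cancel in the determinant and the powers of [m] reduce to one factor, as the
   energy is invariant under reparametrization. *)
have -> : (x1 (sig u) * m u * H2 u - p2 u * m u * H1 u) ^+ 2 / (r * m u) ^+ 5 + lam * (r * m u) =
   m u * ((x1 (sig u) * (- (k * Y (sig u)) * x1 (sig u) - 2 * t) -
     p2 u * - (- (k * Y (sig u)) * y1 (sig u))) ^+ 2 / r ^+ 5 + lam * r).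
  by rewrite /H1 /H2 /x2 /y2; field; rewrite !gt_eqF.
have -> : bd u = m u * ((- (k * Y (sig u))) ^+ 2 + lam +
    t * (- 4 * - (k * Y (sig u)) * x1 (sig u) +
    (lam - 3 * (- (k * Y (sig u))) ^+ 2) * (y1 (sig u) * psi1 (phi u))) + Kc * t ^+ 2).
  rewrite sqrrN (prof_curv prof) /bd /h /G /G1 (prof_curv prof); ring.
by rewrite ler_wpM2l// ltW.
Qed.

End Perturbation.

Lemma profile_unstable : ~ local_minimizer lam l gam.
Proof.
move=> [_ [del [del0 Hmin]]].
have T0' := T0; have L0' := L0; have B1' := B1.
have [M hM] := bounded_within cm.
pose NC := `|norm_const M|.
have NC0 : 0 <= NC by exact: normr_ge0.
(* The bound [1] allows [eps^2 <= eps], [L - T] keeps the second cut on the curve, and the last one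
   makes [(2 * eps)^2 * NC] smaller than [del^2]. *)
pose e0 := Num.min 1 (Num.min (L - T) (del ^+ 2 / (4 * NC + 1))).
have e0p : 0 < e0.
  by rewrite !lt_min ltr01 subr_gt0 TL divr_gt0// ?exprn_gt0//; lra.
have dG0 : is_derive (0 : R) 1 G (G1 0) := dG 0.
have G00 : G 0 = 0 by rewrite /G Y0 mulr0 mul0r.
have G10 : G1 0 != 0.
  rewrite /G1 mulf_neq0 ?(prof_y1 prof)//.
  have := prof_curv prof 0; rewrite Y0 mulr0 expr0n/= => h.
  rewrite mulr0 subr0 (_ : lam = - (2 * k * x1 0)); last by lra.
  by rewrite oppr_eq0 !mulf_neq0 ?(prof_x1 prof) ?(prof_k prof)// gt_eqF.
have [eps /andP[eps0 epse] Ge] := is_derive_neq0 dG0 G00 G10 e0p.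
have [eps1 epsL epsd] : [/\ eps <= 1, eps <= L - T & eps * (4 * NC + 1) < del ^+ 2].
  move: epse; rewrite !lt_min => /and3P[h1 h2 h3]; split; [exact: ltW|exact: ltW|].
  by move: h3; rewrite ltr_pdivlMr//; lra.
pose D := 4 * T * G eps.
have T4 : 0 < 4 * T by lra.
have D0 : D != 0 by rewrite /D mulf_neq0// gt_eqF.
pose Kc := density_const lam L B.
have Kc0 : 0 <= Kc.
  rewrite /Kc /density_const.
  have LB : 0 <= L * B by rewrite mulr_ge0; lra.
  have L2 : 0 <= L ^+ 2 by exact: sqr_ge0.
  have D0' : 0 <= 2 + L * B by lra.
  have Z0' : 0 <= 2 * L + L ^+ 2 by lra.
  have h1 : 0 <= 2 * B * (2 + L * B) by apply: mulr_ge0 => //; lra.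
  have h2 := mulr_ge0 Z0' (addr_ge0 h1 (sqr_ge0 (2 + L * B))).
  have h3 := mulr_ge0 (sqr_ge0 (2 * L + L ^+ 2)) (sqr_ge0 (B + (2 + L * B))).
  have h4 := mulr_ge0 (ltW lam0) L2; have h5 := sqr_ge0 (2 + L * B).
  by apply: addr_ge0 => //; apply: addr_ge0; [apply: addr_ge0 => //|]; apply: mulr_ge0.
pose Z := 2 * L + L ^+ 2.
have Z0 : 0 < Z by rewrite /Z; nra.
(* Upper bound for [|t|]: at most [eps] for closeness, and small enough for the expansion of the
   density. *)
pose h0 := Num.min eps (2 * Z + 2)^-1.
have h0p : 0 < h0 by rewrite lt_min eps0 invr_gt0; lra.
have h0e : h0 <= eps by rewrite /h0 ge_min lexx.
have h0Z : h0 * Z <= 1 / 2.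
  have Z2 : 0 < 2 * Z + 2 by lra.
  have : h0 * (2 * Z + 2) <= 1 by rewrite -ler_pdivlMr// div1r /h0 ge_min lexx orbT.
  lra.
(* With [t = - tau * D] the energy changes by at most [- tau * D^2 * (1 - tau * (Kc * L))]. The
   first factor of the denominator gives [|t| <= h0], the second [tau * (Kc * L) < 1]. *)
pose tau : R := h0 / ((`|D| + 1) * (Kc * L + 1)).
have KL0 : 0 <= Kc * L by rewrite mulr_ge0// ltW.
have D1 : 0 < `|D| + 1 by have := normr_ge0 D; lra.
have tau0 : 0 < tau by rewrite divr_gt0// mulr_gt0//; lra.
have tauE : tau * ((`|D| + 1) * (Kc * L + 1)) = h0.
  by rewrite /tau divfK// gt_eqF// mulr_gt0//; lra.
have tauD : tau * `|D| <= h0.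
  rewrite -tauE ler_pM2l//; have := normr_ge0 D; nra.
have tauK : tau * (Kc * L) < 1.
  have h1 : tau * (Kc * L + 1) <= h0.
    by rewrite -tauE ler_pM2l// ler_peMl//; have := normr_ge0 D; lra.
  rewrite mulrDr mulr1 in h1; lra.
pose t : R := - (tau * D).
have tE : `|t| = tau * `|D| by rewrite /t normrN normrM (gtr0_norm tau0).
have t1 : `|t| <= 1 by rewrite tE; lra.
have tL : `|t| * (2 * L + L ^+ 2) <= 1 / 2.
  by apply: le_trans h0Z; rewrite tE ler_wpM2r// ltW.
have [||a a01 phia] := @IVT _ phi 0 1 eps ler01.
- exact: ac_continuous acphi.
- by rewrite phi0 phi1 ge_min le_max (ltW eps0)/=; apply/orP; right; lra.
have [||b b01 phib] := @IVT _ phi 0 1 (T + eps) ler01.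
- exact: ac_continuous acphi.
- by rewrite phi0 phi1 ge_min le_max; apply/andP; split; apply/orP; [left|right]; lra.
move: a01 b01; rewrite !in_itv/= => /andP[a0 a1] /andP[b0 b1].
have ab : a <= b.
  rewrite leNgt; apply/negP => ba.
  have p (x : R) : 0 <= x <= 1 -> 0 <= m x by move=> /m0/ltW.
  have := ac_le acphi p b0 (ltW ba) a1; rewrite phia phib; lra.
have cA : A_ell l (competitor eps t a b) by exact: competitor_A.
have cN : W22norm (Defs.csub (competitor eps t a b) gam) <=
    Num.sqrt ((eps + `|t|) ^+ 2 * norm_const M) by exact: competitor_norm.
have cE : Elam lam (competitor eps t a b) <=
    2 * k * l + 2 * lam * L + t * (4 * T * G eps) + Kc * L * t ^+ 2 by exact: competitor_energy.
have lt_del : W22norm (Defs.csub (competitor eps t a b) gam) < del.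
  apply: le_lt_trans cN _.
  rewrite -[ltRHS](gtr0_norm del0) -[ltRHS]sqrtr_sqr ltr_sqrt ?exprn_gt0//.
  have n1 : norm_const M <= NC by exact: ler_norm.
  have k1 : eps + `|t| <= 2 * eps by rewrite tE; lra.
  have k0' : 0 <= eps + `|t| by rewrite addr_ge0 ?(ltW eps0).
  have k2 : (eps + `|t|) ^+ 2 <= 4 * eps.
    apply: (@le_trans _ _ ((2 * eps) ^+ 2)); first by apply: sqr_le_sqr; rewrite ger0_norm.
    rewrite exprMn expr2 -natrM ler_wpM2l// expr2.
    by apply: ler_piMr => //; exact: ltW.
  apply: (@le_lt_trans _ _ (4 * eps * NC)).
    apply: (@le_trans _ _ ((eps + `|t|) ^+ 2 * NC)); first by rewrite ler_wpM2l ?sqr_ge0.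
    by rewrite ler_wpM2r.
  lra.
have := le_trans (Hmin _ cA lt_del) cE.
rewrite Elam_profile -/D -/Kc => hfin.
have : t * D + Kc * L * t ^+ 2 < 0.
  rewrite (_ : _ + _ = - (tau * D ^+ 2 * (1 - tau * (Kc * L)))); last by rewrite /t; ring.
  rewrite oppr_lt0 mulr_gt0 ?subr_gt0// mulr_gt0//.
  by rewrite lt_neqAle sqr_ge0 eq_sym sqrf_eq0 D0.
by lra.
Qed.

End Competitor.

(** * Arcs and loops as instances of the profile *)

Section Classification.
Context {R : realType}.

Lemma jacobi_unstable (lam l t : R) (gam Gam : curve R) (n : nat) (q al : R) :
  0 < lam -> 0 < l -> A_ell l gam -> (3 <= n)%N -> t ^+ 2 = 1 ->
  0 <= q < 1 -> 1 / 2 < q ^+ 2 -> gq q = lam * l ^+ 2 / n%:R ^+ 2 ->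
  0 < t * twoEK q -> al = 2 * n%:R / l * (t * twoEK q) ->
  (forall s, Gam s =
    (al^-1 * (t * (2 * ellE (am (al * s - ellK q) q) q + 2 * ellEc q - al * s)),
     al^-1 * (2 * q * cn (al * s - ellK q) q))) ->
  arclength_param_is gam Gam (2 * n%:R * ellK q / al) ->
  ~ local_minimizer lam l gam.
Proof.
move=> lam0 l0 gA n3 t2 q01 q2 gqE' tw0 alE /funext-> gP.
have n0 : 0 < n%:R :> R by rewrite ltr0n (leq_trans _ n3).
have al0 : 0 < al by rewrite alE mulr_gt0// divr_gt0// mulr_gt0.
(* The equation [gq q = lam * l^2 / n^2] is exactly the relation between multiplier and modulus,
   once [al] is expressed through the span [l]. *)
have lamE : al ^+ 2 * (4 * q ^+ 2 - 2) = lam.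
  have -> : lam = gq q * n%:R ^+ 2 / l ^+ 2.
    by rewrite gqE'; field; rewrite !gt_eqF.
  rewrite gqE alE (_ : (2 * n%:R / l * (t * twoEK q)) ^+ 2 =
    t ^+ 2 * (2 * n%:R / l * twoEK q) ^+ 2); last by ring.
  by rewrite t2; field; rewrite gt_eqF.
have prof := jacobi_profile q01 q2 al0 t2 lamE.
have [phi [m [m1 [[acphi acm l2m1 m0] [phi0 phiL gE]]]]] := arclength_reparam prof gA gP.
have [_ [g0 g1]] := gA.
apply: (profile_unstable lam0 prof acphi acm l2m1 m0 phi0 phiL gE g0 g1).
(* The period [4 * ellK q / al] is compared with the length [2 * n * ellK q / al]: a strict
   inequality means [n > 2]. *)
rewrite ltr_pM2r ?invr_gt0// ltr_pM2r ?ellK_gt0//.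
have : 3 <= n%:R :> R by rewrite ler_nat.
lra.
Qed.

End Classification.

Theorem theorem3p7 (R : realType) (lam l : R) (gam : curve R) (n : nat) :
  0 < lam -> 0 < l -> pinned_elastica lam l gam -> (3 <= n)%N ->
  (((nlam lam l <= n%:Z)%R /\ arclength_param_is gam (gamma_sarc lam l n) (len_sarc lam l n))
   \/ ((nlam lam l <= n%:Z)%R /\ arclength_param_is gam (gamma_larc lam l n) (len_larc lam l n))
   \/ arclength_param_is gam (gamma_loop lam l n) (len_loop lam l n)) ->
  ~ local_minimizer lam l gam.
Proof.
move=> lam0 l0 [gA _] n3 H.
have n0 : (0 < n)%N by exact: leq_trans n3.
have c0 : 0 < lam * l ^+ 2 / n%:R ^+ 2.
  by rewrite divr_gt0 ?exprn_gt0 ?ltr0n// mulr_gt0// exprn_gt0.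
case: H => [[hn hP]|[[hn hP]|hP]].
- have [h1 h2 h3 h4] := q1_spec c0 (le_lamhat n0 hn).
  apply: (jacobi_unstable (t := 1) lam0 l0 gA n3 _ h2 h1 h3 _ _ _ hP).
  + exact: expr1n.
  + by rewrite mul1r.
  + by rewrite mul1r.
  + by move=> s; rewrite mul1r.
- have [h1 h2 h3 h4] := q2_spec c0 (le_lamhat n0 hn).
  apply: (jacobi_unstable (t := 1) lam0 l0 gA n3 _ h2 h1 h3 _ _ _ hP).
  + exact: expr1n.
  + by rewrite mul1r.
  + by rewrite mul1r.
  + by move=> s; rewrite mul1r.
- have [h1 h2 h3 h4] := q3_spec c0.
  (* Beyond [qstar] the quantity [twoEK] is negative; the sign [- 1] makes [al] positive and mirrors
     the horizontal coordinate. *)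
  apply: (jacobi_unstable (t := - 1) lam0 l0 gA n3 _ h2 h1 h3 _ _ _ hP).
  + by rewrite sqrrN expr1n.
  + by rewrite mulN1r oppr_gt0.
  + by rewrite /loop_alpha mulN1r opprB.
  + move=> s; rewrite /gamma_loop /loop_curve; congr (_ * _, _).
    by rewrite /loop_q; ring.
Qed.
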